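(* Let $(M,\pi_0,\mathcal{N})$ be an orientable Poisson-Nijenhuis manifold and $\pi_1=\mathcal{N}\pi_0$. For a volume form $\mu$ on $M$ let $X^0_\mu$ and $X^1_\mu$ be the modular vector fields of $\pi_0$ and $\pi_1$ relative to $\mu$. If $\mu$ and $\mu'$ are any two volume forms on $M$, then $$X^1_\mu-\mathcal{N}X^0_\mu=X^1_{\mu'}-\mathcal{N}X^0_{\mu'}.$$ Moreover, this vector field is Poisson relative to $\pi_1$, i.e. its Lie derivative annihilates $\pi_1$.
   Context: Everything is smooth. For a Poisson manifold $(M,\pi)$: $\{f,g\}=\pi(\mathrm{d}f,\mathrm{d}g)$, $\pi^\sharp:T^*M\to TM$ is defined by $\langle\beta,\pi^\sharp\alpha\rangle=\pi(\alpha,\beta)$, and the hamiltonian vector field of $h$ is $X_h=\pi^\sharp\mathrm{d}h=\{h,\cdot\}$. For a volume form $\mu$ on $M$, the divergence of a vector field $X$ is the function with $\mathcal{L}_X\mu=\operatorname{div}_\mu(X)\mu$, and the modular vector field of $\pi$ relative to $\mu$ is the vector field $X_\mu$ with $X_\mu(f)=\operatorname{div}_\mu(X_f)$ for all $f\in C^\infty(M)$. The bracket on 1-forms associated with a bivector $\pi$ is $[\alpha,\beta]_\pi=\mathcal{L}_{\pi^\sharp\alpha}\beta-\mathcal{L}_{\pi^\sharp\beta}\alpha-\mathrm{d}(\pi(\alpha,\beta))$. A Poisson-Nijenhuis manifold $(M,\pi_0,\mathcal{N})$ is a manifold $M$ with a Poisson structure $\pi_0$ and a $(1,1)$-tensor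 $\mathcal{N}:TM\to TM$ such that: (i) the Nijenhuis torsion vanishes, i.e. $\mathcal{N}[\mathcal{N}X,Y]+\mathcal{N}[X,\mathcal{N}Y]-\mathcal{N}^2[X,Y]-[\mathcal{N}X,\mathcal{N}Y]=0$ for all vector fields $X,Y$; (ii) $\mathcal{N}\pi_0^\sharp=\pi_0^\sharp\mathcal{N}^*$ ($\mathcal{N}^*$ is the transpose), so that $\pi_1=\mathcal{N}\pi_0$, defined by $\pi_1^\sharp=\mathcal{N}\pi_0^\sharp$, is a bivector field; (iii) $[\alpha,\beta]_{\pi_1}=[\mathcal{N}^*\alpha,\beta]_{\pi_0}+[\alpha,\mathcal{N}^*\beta]_{\pi_0}-\mathcal{N}^*[\alpha,\beta]_{\pi_0}$ for all 1-forms $\alpha,\beta$. Then $\pi_1$ is a Poisson tensor. *)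

(* Defs.v *)
(* MathComp / MathComp-Analysis.

   Smooth manifolds are given by atlases.  Tensor calculus is set up
   algebraically over the ring C^oo(M): vector fields are the derivations of
   C^oo(M), and tensor fields are the C^oo(M)-multilinear maps on vector fields
   and 1-forms. *)
From HB Require Import structures.
From mathcomp Require Import all_boot all_order all_algebra.
From mathcomp Require Import all_classical all_reals all_analysis.
From mathcomp Require Import ring.

Set Implicit Arguments.
Unset Strict Implicit.
Unset Printing Implicit Defensive.

Import Order.TTheory GRing.Theory Num.Theory.
Import numFieldNormedType.Exports.

Local Open Scope classical_set_scope.
Local Open Scope ring_scope.

Section SmoothEuclidean.
Variables (R : realType) (n : nat).
Implicit Types (U : set 'rV[R]_n) (f g : 'rV[R]_n -> R).

(* Meant for open U; values of f outside U are irrelevant (see [Ck_on_ext]). *)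
Fixpoint Ck_on (k : nat) U f : Prop :=
  (forall x, U x -> {for x, continuous f}) /\
  (if k is k'.+1 then
     forall j : 'I_n, (forall x, U x -> derivable f x (delta_mx 0 j)) /\
       Ck_on k' U (fun x => 'D_(delta_mx 0 j) f x)
   else True).

Definition smooth_on U f : Prop := forall k, Ck_on k U f.

Lemma Ck_on_ext k U f g : open U -> (forall x, U x -> f x = g x) ->
  Ck_on k U f -> Ck_on k U g.
Proof.
move=> oU; have nfg f' g' x : (forall x, U x -> f' x = g' x) -> U x ->
    \near x, f' x = g' x :> R.
  by move=> fg Ux; apply: filterS fg _; exact: open_nbhs_nbhs.
have cfg f' g' : (forall x, U x -> f' x = g' x) ->
    (forall x, U x -> {for x, continuous f'}) ->
    (forall x, U x -> {for x, continuous g'}).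
  move=> fg cf x Ux; rewrite /prop_for /continuous_at -(fg _ Ux).
  exact: cvg_trans (near_eq_cvg (nfg _ _ _ fg Ux)) (cf x Ux).
elim: k f g => [|k IH] f g fg /= [cf df]; first by split=> //; exact: cfg cf.
split=> [|j]; first exact: cfg cf.
have [dfj Cfj] := df j; split=> [x Ux|].
  by apply: near_eq_derivable (dfj x Ux); exact: nfg.
by apply: IH Cfj => x Ux; apply: near_eq_derive; exact: nfg.
Qed.

Lemma Ck_onS k U f : Ck_on k.+1 U f -> Ck_on k U f.
Proof.
elim: k f => [|k IH] f [cf df]; split=> // j.
by have [dfj Cfj] := df j; split=> //; exact: IH.
Qed.

Lemma Ck_on_cst k U a : Ck_on k U (fun=> a).
Proof.
elim: k a => [|k IH] a /=; split=> //; try by move=> x _; exact: (@cvg_cst _ _ _ (nbhs x)).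
move=> j; split=> [x _|]; first exact: derivable_cst.
suff -> : (fun x => 'D_(delta_mx 0 j) (fun=> a) x) =
          (fun=> 0) :> ('rV[R]_n -> R) by exact: IH.
by apply/funext => x; exact: derive_cst.
Qed.

Lemma Ck_onD k U f g : open U -> Ck_on k U f -> Ck_on k U g ->
  Ck_on k U (f + g).
Proof.
move=> oU; elim: k f g => [|k IH] f g /= [cf df] [cg dg].
  by split=> // x Ux; exact: (continuousD (cf x Ux) (cg x Ux)).
split=> [x Ux|j]; first by exact: (continuousD (cf x Ux) (cg x Ux)).
have [dfj Cfj] := df j; have [dgj Cgj] := dg j.
split=> [x Ux|]; first by apply: derivableD; [exact: dfj|exact: dgj].
apply: Ck_on_ext (IH _ _ Cfj Cgj) => // x Ux.
by rewrite deriveD; [|exact: dfj|exact: dgj].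
Qed.

Lemma Ck_onM k U f g : open U -> Ck_on k U f -> Ck_on k U g ->
  Ck_on k U (f * g).
Proof.
move=> oU; elim: k f g => [|k IH] f g Cf Cg.
  case: Cf Cg => cf _ [cg _].
  by split=> // x Ux; exact: (continuousM (cf x Ux) (cg x Ux)).
have Cf' := Ck_onS Cf; have Cg' := Ck_onS Cg.
case: Cf Cg => cf df [cg dg].
split=> [x Ux|j]; first by exact: (continuousM (cf x Ux) (cg x Ux)).
have [dfj Cfj] := df j; have [dgj Cgj] := dg j.
split=> [x Ux|]; first by apply: derivableM; [exact: dfj|exact: dgj].
apply: Ck_on_ext (Ck_onD oU (IH _ _ Cf' Cgj) (IH _ _ Cg' Cfj)) => // x Ux.
by rewrite deriveM; [|exact: dfj|exact: dgj].
Qed.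

End SmoothEuclidean.

(* Hausdorff, second countable, of pure dimension n.  [chart i] is a
   homeomorphism from the open set [cdom i] onto an open subset of R^n, with
   inverse [param i]; both are total functions whose values elsewhere are
   irrelevant. *)
Record manifold (R : realType) (n : nat) := Manifold {
  msort :> topologicalType ;
  cindex : Type ;
  cdom : cindex -> set msort ;
  chart : cindex -> msort -> 'rV[R]_n ;
  param : cindex -> 'rV[R]_n -> msort ;
  m_hausdorff : hausdorff_space msort ;
  m_second_countable : @second_countable msort ;
  cdom_open : forall i, open (cdom i) ;
  cdom_cover : forall p, exists i, cdom i p ;
  ccod_open : forall i, open (chart i @` cdom i) ;
  chartK : forall i p, cdom i p -> param i (chart i p) = p ;
  chart_continuous : forall i p, cdom i p -> {for p, continuous (chart i)} ;
  param_continuous : forall i x, (chart i @` cdom i) x ->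
    {for x, continuous (param i)} ;
  transition_smooth : forall i j (l : 'I_n),
    smooth_on (chart i @` (cdom i `&` cdom j))
      (fun x => chart j (param i x) 0 l)
}.

Section SmoothFunctions.
Variables (R : realType) (n : nat) (M : manifold R n).

Definition smooth (f : M -> R) : Prop :=
  forall i, smooth_on (chart i @` cdom i) (f \o @param _ _ M i).

Definition smooth_pred : {pred (M -> R)} := mem [set f | smooth f].

Record cfun := CFun { cfun_val :> M -> R ; cfunP : cfun_val \in smooth_pred }.

HB.instance Definition _ := [isSub for cfun_val].
HB.instance Definition _ := [Choice of cfun by <:].

Lemma smooth_subring_closed : subring_closed smooth_pred.
Proof.
have sc a : smooth (fun=> a) by move=> i k; exact: Ck_on_cst.
have sM f g : smooth f -> smooth g -> smooth (f * g).
  move=> sf sg i k.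
  exact: (Ck_onM (@ccod_open _ _ M i) (sf i k) (sg i k)).
split=> [|f g|f g]; rewrite !inE/=.
- exact: sc.
- move=> sf sg i k; have sNg := sM _ _ (sc (-1)) sg i k.
  apply: Ck_on_ext (Ck_onD (@ccod_open _ _ M i) (sf i k) sNg) => [|x _].
    exact: ccod_open.
  by rewrite /= !fctE /= mulN1r.
- exact: sM.
Qed.

HB.instance Definition _ :=
  GRing.isSubringClosed.Build _ smooth_pred smooth_subring_closed.
HB.instance Definition _ := GRing.SubChoice_isSubComPzRing.Build _ smooth_pred
  cfun smooth_subring_closed.

Lemma cst_smooth (a : R) : (fun=> a) \in smooth_pred.
Proof. by rewrite inE => i k; exact: Ck_on_cst. Qed.

Definition ccst (a : R) : cfun := CFun (cst_smooth a).

(* [ccst a * f] is scalar multiplication by a : R.  Below, [cfun^o] is C^oo(M) as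
   a module over itself. *)
Definition derivation (X : cfun -> cfun) : Prop :=
  (forall (a : R) f g, X (ccst a * f + g) = ccst a * X f + X g) /\
  (forall f g, X (f * g) = f * X g + g * X f).

Definition derivation_pred : {pred (cfun -> cfun^o)} :=
  mem [set X | derivation X].

Record vfield := VField {
  vfield_val :> cfun -> cfun^o ;
  vfieldP : vfield_val \in derivation_pred
}.

HB.instance Definition _ := [isSub for vfield_val].
HB.instance Definition _ := [Choice of vfield by <:].

Lemma derivation_submod_closed : submod_closed derivation_pred.
Proof.
split; first by rewrite inE; split=> *; rewrite /= !mulr0 addr0.
move=> h X Y; rewrite !inE => -[X1 X2] [Y1 Y2]; split.
  move=> a f g; rewrite !fctE X1 Y1 /GRing.scale /= !mulrDr.
  by rewrite !(mulrCA h) addrACA.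
move=> f g; rewrite !fctE X2 Y2 /GRing.scale /= !mulrDr.
by rewrite !(mulrCA h) addrACA.
Qed.

HB.instance Definition _ :=
  GRing.isSubmodClosed.Build _ _ derivation_pred derivation_submod_closed.
HB.instance Definition _ := [SubChoice_isSubLmodule of vfield by <:].

Definition oneform_pred : {pred (vfield -> cfun^o)} :=
  mem [set al : vfield -> cfun^o | linear al].

Record oneform := OneForm {
  oneform_val :> vfield -> cfun^o ;
  oneformP : oneform_val \in oneform_pred
}.

HB.instance Definition _ := [isSub for oneform_val].
HB.instance Definition _ := [Choice of oneform by <:].

Lemma oneform_submod_closed : submod_closed oneform_pred.
Proof.
split; first by rewrite inE => h X Y; rewrite scaler0 addr0.
move=> h a b; rewrite !inE => la lb k X Y.
rewrite !fctE la lb !scalerDr !scalerA (mulrC h k) -!addrA; congr (_ + _).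
by rewrite addrCA.
Qed.

HB.instance Definition _ :=
  GRing.isSubmodClosed.Build _ _ oneform_pred oneform_submod_closed.
HB.instance Definition _ := [SubChoice_isSubLmodule of oneform by <:].

End SmoothFunctions.

Section Calculus.
Variables (R : realType) (n : nat) (M : manifold R n).
Local Notation C := (cfun M).
Local Notation VF := (vfield M).
Local Notation OF := (oneform M).

Lemma vfield_linear (X : VF) (a : R) (f g : C) :
  X (ccst M a * f + g) = ccst M a * X f + X g.
Proof. by case: X => X /=; rewrite inE => -[]. Qed.

Lemma vfieldM (X : VF) (f g : C) : X (f * g) = f * X g + g * X f :> C.
Proof. by case: X => X /=; rewrite inE => -[]. Qed.

Lemma ccst1 : ccst M 1 = 1.
Proof. exact/val_inj. Qed.

Lemma vfieldD (X : VF) (f g : C) : X (f + g) = X f + X g :> C.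
Proof. by have := vfield_linear X 1 f g; rewrite ccst1 !mul1r. Qed.

Lemma oneform_linear (al : OF) : linear (al : VF -> C^o).
Proof. by case: al => al /=; rewrite inE. Qed.

Lemma oneformD (al : OF) (X Y : VF) : al (X + Y) = al X + al Y :> C.
Proof. by have := oneform_linear al 1 X Y; rewrite !scale1r. Qed.

Lemma bracket_subproof (X Y : VF) :
  (fun f => X (Y f) - Y (X f) : C^o) \in @derivation_pred _ _ M.
Proof.
rewrite inE; split=> [a f g|f g].
  by rewrite !vfield_linear; ring.
by rewrite !vfieldM !vfieldD !vfieldM; ring.
Qed.

Definition bracket (X Y : VF) : VF := VField (bracket_subproof X Y).

Lemma dif_subproof (f : C) : (fun X : VF => X f) \in @oneform_pred _ _ M.
Proof. by rewrite inE. Qed.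

Definition dif (f : C) : OF := OneForm (dif_subproof f).

Lemma lie1_subproof (X : VF) (al : OF) :
  (fun Y : VF => X (al Y) - al (bracket X Y) : C^o) \in @oneform_pred _ _ M.
Proof.
rewrite inE => h Y Z.
have -> : bracket X (h *: Y + Z) = h *: bracket X Y + ((X h) *: Y + bracket X Z).
  apply/val_inj/funext => f /=.
  rewrite -[LHS]/(X (h * Y f + Z f) - (h * Y (X f) + Z (X f)) : C).
  rewrite -[RHS]/(h * (X (Y f) - Y (X f)) + (X h * Y f + (X (Z f) - Z (X f))) : C).
  by rewrite vfieldD vfieldM; ring.
rewrite !oneform_linear vfieldD vfieldM.
rewrite /GRing.scale /=; ring.
Qed.

(* (L_X al)(Y) = X(al(Y)) - al([X, Y]) *)
Definition lie1 (X : VF) (al : OF) : OF := OneForm (lie1_subproof X al).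

Definition tensor11 := {linear VF -> VF}.

Lemma transpose_subproof (N : tensor11) (al : OF) :
  (fun X : VF => al (N X)) \in @oneform_pred _ _ M.
Proof. by rewrite inE => h X Y; rewrite linearP oneform_linear. Qed.

Definition transpose (N : tensor11) (al : OF) : OF :=
  OneForm (transpose_subproof N al).

(* A bivector field pi is encoded by pi^sharp : T^*M -> TM; the defining relation
   <be, pi^sharp al> = pi(al, be) of pi^sharp then gives back pi, see [pairing],
   and pi is alternating by [sharp_alt]. *)
Record bivector := Bivector {
  sharp : {linear OF -> VF} ;
  sharp_alt : forall al : OF, al (sharp al) = 0
}.

Definition pairing (pi : bivector) (al be : OF) : C := be (sharp pi al).

Definition poisson_bracket (pi : bivector) (f g : C) : C :=
  pairing pi (dif f) (dif g).

Definition jacobi (pi : bivector) : Prop := forall f g h : C,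
  poisson_bracket pi f (poisson_bracket pi g h) +
  poisson_bracket pi g (poisson_bracket pi h f) +
  poisson_bracket pi h (poisson_bracket pi f g) = 0.

Definition hamiltonian (pi : bivector) (h : C) : VF := sharp pi (dif h).

Definition form_bracket (pi : bivector) (al be : OF) : OF :=
  lie1 (sharp pi al) be - lie1 (sharp pi be) al - dif (pairing pi al be).

(* (L_X pi)(al, be) *)
Definition lie_bivector (X : VF) (pi : bivector) (al be : OF) : C :=
  X (pairing pi al be) - pairing pi (lie1 X al) be - pairing pi al (lie1 X be).

Definition poisson_field (pi : bivector) (X : VF) : Prop :=
  forall al be : OF, lie_bivector X pi al be = 0.

Definition torsion (N : tensor11) (X Y : VF) : VF :=
  N (bracket (N X) Y) + N (bracket X (N Y)) - N (N (bracket X Y))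
  - bracket (N X) (N Y).

Definition compatible (N : tensor11) (pi : bivector) : Prop :=
  forall al : OF, N (sharp pi al) = sharp pi (transpose N al).

Lemma tensor_bivector_subproof (N : tensor11) (pi : bivector) :
  compatible N pi -> forall al : OF, al (N (sharp pi al)) = 0.
Proof.
move=> Npi al.
have alt (be ga : OF) : be (sharp pi ga) = - ga (sharp pi be) :> C.
  have := sharp_alt pi (be + ga); rewrite linearD.
  rewrite -[X in X = _ -> _]/(be (sharp pi be + sharp pi ga)
                              + ga (sharp pi be + sharp pi ga) : C).
  rewrite !oneformD !sharp_alt add0r addr0 => /eqP.
  by rewrite addr_eq0 => /eqP.
have xN : al (N (sharp pi al)) = - al (N (sharp pi al)) :> C.
  by rewrite {2}Npi (alt al) opprK.
apply/val_inj/funext => p /=.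
have := congr1 (fun f : C => f p) xN => /= /eqP.
by rewrite -addr_eq0 -mulr2n mulrn_eq0 /= => /eqP.
Qed.

(* N pi, given by (N pi)^sharp = N pi^sharp. *)
Definition tensor_bivector (N : tensor11) (pi : bivector)
    (Npi : compatible N pi) : bivector :=
  @Bivector (N \o sharp pi) (tensor_bivector_subproof Npi).

Record poisson_nijenhuis := PoissonNijenhuis {
  pn_pi0 : bivector ;
  pn_N : tensor11 ;
  pn_jacobi : jacobi pn_pi0 ;
  pn_torsion : forall X Y : VF, torsion pn_N X Y = 0 ;
  pn_compatible : compatible pn_N pn_pi0 ;
  pn_form_bracket : forall al be : OF,
    form_bracket (tensor_bivector pn_compatible) al be =
    form_bracket pn_pi0 (transpose pn_N al) be
    + form_bracket pn_pi0 al (transpose pn_N be)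
    - transpose pn_N (form_bracket pn_pi0 al be)
}.

Definition pn_pi1 (P : poisson_nijenhuis) : bivector :=
  tensor_bivector (pn_compatible P).

(* Differential forms of top degree n; [eta v with i |-> X] is the family v with
   its i-th entry replaced by X. *)
Record topform := TopForm {
  topform_val :> ('I_n -> VF) -> C ;
  topform_linear : forall (v : 'I_n -> VF) (i : 'I_n) (f : C) (X Y : VF),
    topform_val [eta v with i |-> f *: X + Y] =
    f * topform_val [eta v with i |-> X] + topform_val [eta v with i |-> Y] ;
  topform_alt : forall (v : 'I_n -> VF) (i j : 'I_n), i != j -> v i = v j ->
    topform_val v = 0
}.

(* The value of mu at p is nonzero iff mu takes a nonzero value at p on some
   vector fields, as every tangent vector extends to a vector field. *)
Record volume_form := VolumeForm {
  volume_val :> topform ;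
  volume_neq0 : forall p : M, exists v : 'I_n -> VF, volume_val v p != 0
}.

Definition orientable : Prop := inhabited volume_form.

(* (L_X mu)(v_1, .., v_n) = X(mu(v_1, .., v_n))
                            - sum_i mu(v_1, .., [X, v_i], .., v_n) *)
Definition lie_topform (X : VF) (mu : topform) (v : 'I_n -> VF) : C :=
  X (mu v) - \sum_(i < n) mu [eta v with i |-> bracket X (v i)].

(* d = div_mu(X), i.e. L_X mu = d mu; such a d is unique as mu vanishes nowhere. *)
Definition is_divergence (mu : volume_form) (X : VF) (d : C) : Prop :=
  forall v : 'I_n -> VF, lie_topform X mu v = d * mu v.

(* X(f) = div_mu(X_f) for all f *)
Definition is_modular_field (pi : bivector) (mu : volume_form) (X : VF) :
    Prop :=
  forall f : C, is_divergence mu (hamiltonian pi f) (X f).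

End Calculus.

(* Main.v *)
Require Import Defs.
From HB Require Import structures.
From mathcomp Require Import all_boot all_order all_algebra.
From mathcomp Require Import fingroup perm.
From mathcomp Require Import all_classical all_reals all_analysis.
From mathcomp Require Import ring.
Set Implicit Arguments.
Unset Strict Implicit.
Unset Printing Implicit Defensive.
Import Order.TTheory GRing.Theory Num.Theory.
Import numFieldNormedType.Exports.
Local Open Scope classical_set_scope.
Local Open Scope ring_scope.

(** Write H_f for the hamiltonian field of f with respect to pi_0, and H1_f =
    N H_f for the one with respect to pi_1.

    Independence of the volume form.  Two volume forms are proportional, so
    mu(v) mu'(w) = mu'(v) mu(w) for all families v and w [volume_rank1].  With
    a = mu(v) and b = mu'(v), differentiating along H_f gives, for every
    bivector, a b (X_mu' - X_mu) = b H_a - a H_b [modular_change].  The right-hand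
    side for pi_1 is the image under N of the one for pi_0, hence so is the
    left-hand side.  Using a and b instead of the ratio b / a avoids having to
    show that this ratio is smooth.

    The field is Poisson.  L_X pi = 0 holds as soon as [X, H_f] = H_(X f) for all
    f [preserves_poisson_field].  A modular field has this property whenever
    f |-> H_f is a morphism for the Poisson bracket, because
    div [X, Y] = X (div Y) - Y (div X) [modular_preserves].  This applies to pi_0,
    and to pi_1 because the compatibility of the brackets on 1-forms, taken on
    exact forms, together with the vanishing torsion, carries the morphism
    property over [pn_hamiltonian_morphism1].  Finally, if X preserves pi_0 then
    N X preserves pi_1 [preserves_hamiltonians_tensor]: by the vanishing torsion it
    is enough that
      [N X, H_f] + [X, N H_f] - N [X, H_f] = pi_0^sharp d((N X) f),
    and applied to g this is the same compatibility for df and dg, evaluated at X.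

    Both arguments rest on one fact about vector fields, defined here as
    derivations of C^oo(M): near each point they are combinations of n fixed
    ones, with coefficients given by 1-forms that are combinations of exact ones
    [local_frame].  It makes alternating n-forms proportional
    [form_vanish], and makes a tensorial expression in a 1-form vanish once it
    vanishes on exact forms [oneform_tensor_eq0].  Its proof is the classical
    one: a derivation sees only the first-order Taylor polynomial of a function,
    by Hadamard's lemma [hadamard], and local objects become global after
    multiplication by a bump function [smooth_ext0].  The calculus
    this requires is developed first: partial derivatives that are continuous
    give a differential, smooth functions compose, exp(-1/t) is flat at 0, and
    integrals over [0, 1] depend smoothly on parameters. *)

(** * Differentiability of functions with continuous partial derivatives *)

Section MeanValue.
Variables (R : realType) (V : normedModType R).
Implicit Types (f : V -> R) (x v : V).

Lemma is_derive_line f x v (s : R) : derivable f (x + s *: v) v ->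
  is_derive s 1 (fun s => f (x + s *: v)) ('D_v f (x + s *: v)).
Proof.
have e : (fun h : R => h^-1 *: (((fun s : R => f (x + s *: v)) \o shift s) (h *: 1)
            - f (x + s *: v)))
       = (fun h : R => h^-1 *: ((f \o shift (x + s *: v)) (h *: v)
            - f (x + s *: v))).
  apply/funext => h /=; congr (_ *: (f _ - _)).
  by rewrite scalerDl scaler1 addrCA.
by move=> df; split; rewrite /derivable /derive e.
Qed.

(** The sign of t is arbitrary and the derivative is compared with any constant
    c: this form serves both for the differential of a function of several
    variables and for differentiation under the integral sign. *)
Lemma mvt_line f x v (t c eps : R) :
  (forall s : R, `|s| <= `|t| ->
     derivable f (x + s *: v) v /\ `|'D_v f (x + s *: v) - c| <= eps) ->
  `|f (x + t *: v) - f x - t * c| <= eps * `|t|.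
Proof.
move=> H; pose g (s : R) := f (x + s *: v).
have dg (s : R) : `|s| <= `|t| -> is_derive s 1 g ('D_v f (x + s *: v)).
  by move=> /H[? _]; exact: is_derive_line.
have cg (s : R) : `|s| <= `|t| -> {for s, continuous g}.
  by move=> /dg[+ _]; move/derivable1_diffP/differentiable_continuous.
have f0 : f x = g 0 by rewrite /g scale0r addr0.
have key (a b : R) : a <= b -> (forall s, a <= s <= b -> `|s| <= `|t|) ->
    `|g b - g a - (b - a) * c| <= eps * (b - a).
  move=> ab abt.
  have [||s /= sab ->] := @MVT_segment R g (fun s => 'D_v f (x + s *: v)) a b ab.
  - move=> s; rewrite in_itv /= => /andP[/ltW ? /ltW ?].
    by apply/dg/abt/andP.
  - apply: continuous_in_subspaceT => s; rewrite inE /= in_itv /= => sab.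
    by apply: cg; apply: abt.
  rewrite mulrC -mulrBr normrM mulrC (ger0_norm (_ : 0 <= b - a)) ?subr_ge0//.
  apply: ler_wpM2r; first by rewrite subr_ge0.
  by have /abt/H[] := sab.
have [t0|t0] := leP 0 t.
  have := key 0 t t0; rewrite subr0 ger0_norm// f0; apply=> s /andP[s0 st].
  by rewrite !ger0_norm.
rewrite f0 -/(g t) [`|t|]ltr0_norm//.
have -> : g t - g 0 - t * c = - (g 0 - g t - (0 - t) * c) by ring.
rewrite normrN -[- t in leRHS]sub0r; apply: key; first exact: ltW.
by move=> s /andP[ts s0]; rewrite !ler0_norm ?lerN2// ltW.
Qed.

End MeanValue.

Section C1.
Variables (R : realType) (n : nat).
Implicit Types (U : set 'rV[R]_n) (f g : 'rV[R]_n -> R).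

Lemma coord_le_norm (h : 'rV[R]_n) (i : 'I_n) : `|h 0 i| <= `|h|.
Proof.
rewrite [leRHS]/Num.Def.normr/= mx_normrE.
exact: (le_bigmax _ (fun ij => `|h ij.1 ij.2|) (ord0, i)).
Qed.

Lemma norm_le_coord (h : 'rV[R]_n) (e : R) : 0 <= e ->
  (forall i, `|h 0 i| <= e) -> `|h| <= e.
Proof.
move=> e0 he; rewrite [leLHS]/Num.Def.normr/= mx_normrE.
by apply: bigmax_le => // -[i j] _ /=; rewrite ord1.
Qed.

(** The increment of f along h is split into n increments along the coordinate
    axes, by switching on the entries of h one after the other; the mean value
    theorem compares each with the partial derivative at y. *)
Lemma differentiable_C1 f y :
  (\forall z \near y, forall l : 'I_n, derivable f z (delta_mx 0 l)) ->
  (forall l : 'I_n, {for y, continuous (fun z => 'D_(delta_mx 0 l) f z)}) ->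
  differentiable f y.
Proof.
move=> df cdf.
pose L (h : 'rV[R]_n) : R := \sum_l h 0 l * 'D_(delta_mx 0 l) f y.
have linL : linear L.
  move=> a h k; rewrite /L scaler_sumr -big_split /=; apply: eq_bigr => l _.
  by rewrite !mxE mulrDl -mulrA.
pose L' : {linear 'rV[R]_n -> R} :=
  HB.pack L (GRing.isLinear.Build _ _ _ _ L linL).
have cL : continuous L.
  rewrite /L; apply: continuous_big => [|l _ h]; first exact: add_continuous.
  have cl : {for h, continuous (fun h : 'rV[R]_n => h 0 l)} by exact: coord_continuous.
  exact: (continuousM cl (@cst_continuous _ _ ('D_(delta_mx 0 l) f y) h)).
have expand : f \o shift y = cst (f y) + L' +o_ 0 id.
  apply/eqaddoP => _/posnumP[e].
  have e0 : 0 < e%:num / n.+1%:R by rewrite divr_gt0.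
  have : \forall z \near y, forall l : 'I_n, derivable f z (delta_mx 0 l) /\
      `|'D_(delta_mx 0 l) f z - 'D_(delta_mx 0 l) f y| <= e%:num / n.+1%:R.
    have : \forall z \near y, forall l : 'I_n,
        `|'D_(delta_mx 0 l) f z - 'D_(delta_mx 0 l) f y| <= e%:num / n.+1%:R.
      apply: (@filter_forall _ _ (fun l z =>
        `|'D_(delta_mx 0 l) f z - 'D_(delta_mx 0 l) f y| <= e%:num / n.+1%:R)
        (nbhs y)) => l.
      by have /cvgrPdist_le/(_ _ e0) := cdf l; apply: filterS => z; rewrite distrC.
    by apply: filterS2 df => z ? ? l.
  move=> /nbhs_ballP[d d0 Bd].
  near=> h.
  have hd : `|h| < d.
    near: h; apply/nbhs_ballP; exists d => // h.
    by rewrite -ball_normE /= sub0r normrN.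
  (* p k is y + h with only the first k entries of h switched on. *)
  pose p (k : nat) : 'rV[R]_n := y + \row_(i < n) (if (i < k)%N then h 0 i else 0).
  have pn : p n = h + y.
    rewrite /p addrC; congr (_ + _); apply/rowP => i; rewrite mxE ltn_ord//.
  have p0 : p 0%N = y.
    by rewrite /p; rewrite -[RHS]addr0; congr (_ + _); apply/rowP => i; rewrite !mxE.
  have pS (k : 'I_n) : p k.+1 = p k + h 0 k *: delta_mx 0 k.
    rewrite /p -addrA; congr (_ + _); apply/rowP => i; rewrite !mxE /= ltnS leq_eqVlt.
    rewrite -val_eqE /=; have [ik|ik] /= := eqVneq (i : nat) k.
      by rewrite ik ltnn add0r mulr1; congr (h _ _); exact/val_inj.
    by rewrite mulr0 addr0.
  rewrite /= -![(_ + _ : _ -> _) _]/(_ + _) -![(- _ : _ -> _) _]/(- _) /cst /=.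
  rewrite -[X in `|X|]/(f (h + y) - (f y + L h)).
  rewrite -pn -[in f y]p0 opprD addrA -(telescope_sumr (fun k => f (p k)))//.
  rewrite big_mkord /L -sumrB.
  apply: (le_trans (ler_norm_sum _ _ _)).
  apply: (@le_trans _ _ (\sum_(i < n) e%:num / n.+1%:R * `|h|)).
    apply: ler_sum => k _; rewrite pS.
    apply: le_trans (_ : _ <= e%:num / n.+1%:R * `|h 0 k|) _; last first.
      by apply: ler_wpM2l; [exact: ltW|exact: coord_le_norm].
    apply: mvt_line => s sk; apply: Bd; rewrite -ball_normE /=.
    apply: le_lt_trans hd.
    rewrite /p -addrA opprD addrA subrr sub0r normrN.
    apply: norm_le_coord => // i; rewrite !mxE /=.
    have [->|ik] := eqVneq i k.
      by rewrite ltnn add0r mulr1 (le_trans sk)// coord_le_norm.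
    by rewrite mulr0 addr0; case: ifP => _; rewrite ?normr0// coord_le_norm.
  rewrite sumr_const card_ord -[leLHS]mulr_natr.
  rewrite [leLHS](_ : _ = e%:num * (n.+1%:R^-1 * n%:R * `|h|)); last first.
    by rewrite -!mulrA; congr (_ * (_ * _)); rewrite mulrC.
  apply: ler_wpM2l => //; apply: ler_piMl => //.
  by rewrite ler_pdivrMl// mulr1 ler_nat.
have dE : 'd f y = L' :> (_ -> _) by apply: diff_unique.
by apply/diff_locallyP; rewrite dE.
Unshelve. all: by end_near. Qed.

End C1.

(** * Chain rule and stability of smoothness *)

Section Smooth.
Variables (R : realType).

Lemma continuous_row n (T : topologicalType) (phi : T -> 'rV[R]_n) (x : T) :
  (forall l, {for x, continuous (fun z => phi z 0 l)}) -> {for x, continuous phi}.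
Proof.
move=> cphi; apply/cvgrPdist_le => e e0.
have : \forall z \near x, forall l, `|phi x 0 l - phi z 0 l| <= e.
  apply: (@filter_forall _ _ (fun l z => `|phi x 0 l - phi z 0 l| <= e)
    (nbhs x)) => l.
  by have /cvgrPdist_le/(_ _ e0) := cphi l.
apply: filterS => z ze; apply: norm_le_coord; first exact: ltW.
by move=> l; rewrite !mxE.
Qed.

Lemma derive_partial n (f : 'rV[R]_n -> R) (y v : 'rV[R]_n) :
  differentiable f y -> 'D_v f y = \sum_l v 0 l * 'D_(delta_mx 0 l) f y.
Proof.
move=> df; rewrite deriveE// {1}(row_sum_delta v) linear_sum; apply: eq_bigr => l _.
by rewrite linearZ /= deriveE.
Qed.

(** Only the derivative of phi in the direction v is assumed: f is composed with
    the curve s |-> phi (s v + x), which is differentiable because it depends on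
    a single real variable. *)
Lemma is_derive_comp n (V : normedModType R) (f : 'rV[R]_n -> R)
    (phi : V -> 'rV[R]_n) (x v : V) :
  differentiable f (phi x) ->
  (forall l, derivable (fun z => phi z 0 l) x v) ->
  is_derive x v (f \o phi)
    (\sum_l 'D_v (fun z => phi z 0 l) x * 'D_(delta_mx 0 l) f (phi x)).
Proof.
move=> df dphi.
have dp : derivable phi x v by apply/derivable_mxP => i j; rewrite ord1.
pose g (s : R) := phi (s *: v + x).
have dg : derivable g (0 : R) 1 by exact: (iffLR (derivable1P phi x v) dp).
have g0 : g 0 = phi x by rewrite /g scale0r add0r.
have dfg : differentiable f (g (0 : R)). by rewrite g0.
have dg' : differentiable g 0 by apply/derivable1_diffP.
have dc : differentiable (f \o g) 0 by exact: differentiable_comp.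
have E (W : normedModType R) (h : V -> W) :
    'D_v h x = 'D_1 (fun s : R => h (s *: v + x)) 0.
  apply: (congr1 (fun k : R -> W => lim (k s @[s --> 0^']))).
  apply/funext => s /=.
  by rewrite addr0 scale0r add0r scaler1.
split.
  have ddc : derivable (f \o g) (0 : R) 1 by exact/derivable1_diffP.
  exact: (iffRL (derivable1P (f \o phi) x v) ddc).
rewrite E deriveE// (_ : (fun s : R => _) = f \o g)// diff_comp//= g0.
rewrite -(deriveE _ dg') -deriveE// derive_partial//.
apply: eq_bigr => l _; congr (_ * _).
by rewrite derive_mx// mxE (E _ (fun z => phi z 0 l)).
Qed.

Lemma Ck_on_differentiable n k (U : set 'rV[R]_n) f x :
  open U -> Ck_on k.+1 U f -> U x -> differentiable f x.
Proof.
move=> oU [_ df] Ux; apply: differentiable_C1.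
  by apply: filterS (open_nbhs_nbhs (conj oU Ux)) => z Uz l; have [+ _] := df l; exact.
by move=> l; have [_] := df l; case: k {df} => [|k] [+ _]; exact.
Qed.

Lemma Ck_on_cont n k (U : set 'rV[R]_n) f x :
  Ck_on k U f -> U x -> {for x, continuous f}.
Proof. by case: k => [|k] [+ _]; exact. Qed.

Lemma Ck_on_sum n k (U : set 'rV[R]_n) m (F : 'I_m -> 'rV[R]_n -> R) :
  open U -> (forall i, Ck_on k U (F i)) -> Ck_on k U (fun x => \sum_i F i x).
Proof.
move=> oU CF; rewrite -fct_sumE.
apply: (big_ind (Ck_on k U)) => //; first exact: Ck_on_cst.
by move=> f g; exact: Ck_onD.
Qed.

(** The partial derivatives of f o phi are sums of products of partial
    derivatives of phi and of functions (D_l f) o phi, so the induction on k must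
    quantify over f. *)
Lemma Ck_on_comp m n k (U : set 'rV[R]_m) (W : set 'rV[R]_n)
    (f : 'rV[R]_n -> R) (phi : 'rV[R]_m -> 'rV[R]_n) :
  open U -> open W -> (forall l, Ck_on k U (fun x => phi x 0 l)) ->
  (forall x, U x -> W (phi x)) -> Ck_on k W f -> Ck_on k U (f \o phi).
Proof.
move=> oU oW; elim: k f => [|k IH] f Cphi UW Cf.
  split=> // x Ux; apply: continuous_comp.
    by apply: continuous_row => l; exact: Ck_on_cont (Cphi l) Ux.
  exact: Ck_on_cont Cf (UW _ Ux).
have Dc x j : U x -> is_derive x (delta_mx 0 j) (f \o phi)
    (\sum_l 'D_(delta_mx 0 j) (fun z => phi z 0 l) x *
            'D_(delta_mx 0 l) f (phi x)).
  move=> Ux; apply: is_derive_comp.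
    exact: Ck_on_differentiable oW Cf (UW _ Ux).
  by move=> l; have [_ /(_ j)[+ _]] := Cphi l; exact.
split.
  move=> x Ux; apply: continuous_comp.
    by apply: continuous_row => l; exact: Ck_on_cont (Cphi l) Ux.
  exact: Ck_on_cont Cf (UW _ Ux).
move=> j; split=> [x Ux|]; first by have [] := Dc x j Ux.
apply: (@Ck_on_ext R m k U (fun x => \sum_l
    ((fun x => 'D_(delta_mx 0 j) (fun z => phi z 0 l) x) *
     ((fun y => 'D_(delta_mx 0 l) f y) \o phi)) x) _ oU).
  by move=> x Ux; have [_ ->] := Dc x j Ux.
apply: Ck_on_sum => // l; apply: Ck_onM => //.
  by have [_ /(_ j)[]] := Cphi l.
apply: IH => //; last by have [_ /(_ l)[]] := Cf.
by move=> i; exact: Ck_onS.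
Qed.

Section SmoothOn.
Variable n : nat.
Implicit Types (U : set 'rV[R]_n) (f g : 'rV[R]_n -> R).

Lemma Ck_onW k U U' f : U' `<=` U -> Ck_on k U f -> Ck_on k U' f.
Proof.
move=> sU; elim: k f => [|k IH] f [cf df]; split=> //; try by move=> x /sU/cf.
by move=> j; have [dfj Cfj] := df j; split=> [x /sU/dfj//|]; exact: IH.
Qed.

Lemma Ck_onU k U U' f : Ck_on k U f -> Ck_on k U' f -> Ck_on k (U `|` U') f.
Proof.
elim: k f => [|k IH] f [cf df] [cf' df']; split=> //;
  try by move=> x [/cf|/cf'].
move=> j; have [dfj Cfj] := df j; have [dfj' Cfj'] := df' j.
by split=> [x [/dfj|/dfj']//|]; exact: IH.
Qed.

Lemma smooth_on_derive U f j :
  smooth_on U f -> smooth_on U (fun x => 'D_(delta_mx 0 j) f x).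
Proof. by move=> sf k; have [_ /(_ j)[]] := sf k.+1. Qed.

Lemma smooth_on_derivable U f j x :
  smooth_on U f -> U x -> derivable f x (delta_mx 0 j).
Proof. by move=> /(_ 1)[_ /(_ j)[+ _]]; exact. Qed.

Lemma Ck_on_coord k U (l : 'I_n) : Ck_on k U (fun x => x 0 l).
Proof.
case: k => [|k]; first by split=> // x _; exact: coord_continuous.
have D x j : is_derive x (delta_mx 0 j) (fun x : 'rV[R]_n => x 0 l)
    ((delta_mx 0 j : 'rV[R]_n) 0 l).
  have dx : differentiable (fun x : 'rV[R]_n => x 0 l) x by exact: differentiable_coord.
  split; first exact: diff_derivable.
  rewrite /derive; apply: cvg_lim => //.
  apply: (@cvg_trans _ ((fun=> (delta_mx 0 j : 'rV[R]_n) 0 l) @ (0 : R)^')); last first.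
    exact: cvg_cst.
  apply: near_eq_cvg; near=> h.
  rewrite /= !mxE addrK /GRing.scale /= mulKf//.
  by near: h; exact: nbhs_dnbhs_neq.
split=> [x _|j]; first exact: coord_continuous.
split=> [x _|]; first by have [] := D x j.
rewrite (_ : (fun x => _) = fun=> (delta_mx 0 j : 'rV[R]_n) 0 l).
  exact: Ck_on_cst.
by apply/funext => x; have [] := D x j.
Unshelve. all: by end_near. Qed.

End SmoothOn.
End Smooth.

(** * Bump functions *)

Section Bump.
Variable R : realType.

(** The powers of 1/t make the family stable under differentiation: the
    derivative of [flat m] is a combination of [flat m.+1] and [flat m.+2]. *)
Definition flat (m : nat) (t : R) : R :=
  if 0 < t then t^-1 ^+ m * expR (- t^-1) else 0.

Lemma flat_gt0 t : 0 < t -> 0 < flat 0 t.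
Proof. by move=> t0; rewrite /flat t0 mul1r expR_gt0. Qed.

Lemma flat_eq0 m t : t <= 0 -> flat m t = 0.
Proof. by rewrite /flat leNgt => /negPf ->. Qed.

(** The exponential series gives u^(m+2) <= (m+2)! exp(u), used at u = 1/t.  A
    quadratic bound is what gives derivative 0 at t = 0. *)
Lemma flat_bound m t : `|flat m t| <= m.+2`!%:R * t ^+ 2.
Proof.
have [t0|t0] := ltP 0 t; last first.
  by rewrite flat_eq0// normr0 mulr_ge0// sqr_ge0.
rewrite /flat t0 expRN ger0_norm; last first.
  by rewrite mulr_ge0// ?invr_ge0 ?expR_ge0// exprn_ge0// invr_ge0 ltW.
have u0 : 0 <= t^-1 by rewrite invr_ge0 ltW.
have := expR_ge1Dxn m.+1 u0; set u := t^-1 => Hu.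
have {}Hu : u ^+ m.+2 <= m.+2`!%:R * expR u.
  rewrite -ler_pdivrMl ?ltr0n ?fact_gt0// mulrC.
  by apply: le_trans Hu; rewrite lerDr.
rewrite ler_pdivrMr ?expR_gt0// mulrAC -ler_pdivrMr ?exprn_gt0//.
by rewrite -exprVn -exprD addn2.
Qed.

Lemma is_derive_flat m (t : R) :
  is_derive t 1 (flat m) (flat m.+2 t - m%:R * flat m.+1 t).
Proof.
have [t0|t0|->] := ltgtP t 0.
- have E : \near t, cst 0 t = flat m t.
    near=> s; rewrite flat_eq0//; apply: ltW.
    by near: s; exact: lt_nbhsl.
  apply: (near_eq_is_derive E).
  by rewrite !flat_eq0 ?ltW// mulr0 subrr; exact: is_derive_cst.
- have E : \near t, (fun s => s^-1 ^+ m * expR (- s^-1)) t = flat m t.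
    near=> s; rewrite /flat ifT//.
    by near: s; exact: lt_nbhsr.
  apply: (near_eq_is_derive E).
  rewrite /flat t0.
  have tn0 : t != 0 by rewrite gt_eqF.
  have iV : is_derive t 1 (fun s : R => s^-1) (- t ^- 2 *: 1).
    exact: is_deriveV.
  have iE := @is_derive1_comp _ expR (- (fun s : R => s^-1)) _ _ _
    (is_derive_expR (- t^-1)) (is_deriveN iV).
  have := is_deriveM (is_deriveX m iV) iE.
  rewrite (_ : _ * _ = (fun s => s^-1 ^+ m * expR (- s^-1))); last first.
    by apply/funext => s; rewrite !fctE.
  move/is_derive_eq; apply; rewrite !fctE /GRing.scale /= !mulr1.
  case: m {E} => [|m].
    by rewrite !expr0; field.
  by rewrite -[m.+1.-1]/m !exprS; field.
- rewrite !flat_eq0// mulr0 subrr.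
  have H : (fun h : R => h^-1 *: ((flat m \o shift 0) (h *: 1) - flat m 0))
      @ 0^' --> (0 : R).
    apply/cvgrPdist_le => e e0.
    have c0 : 0 < (m.+2)`!%:R :> R by rewrite ltr0n fact_gt0.
    near=> h.
    have h0 : h != 0 by near: h; exact: nbhs_dnbhs_neq.
    rewrite sub0r normrN /= addr0 scaler1 (flat_eq0 _ (lexx 0)) subr0.
    rewrite normrM normfV ler_pdivrMl ?normr_gt0//.
    apply: (le_trans (flat_bound _ _)).
    rewrite -real_normK ?num_real// expr2 mulrCA ler_wpM2l//.
    rewrite -ler_pdivlMl//.
    near: h; apply: dnbhs0_le.
    by rewrite mulr_gt0// invr_gt0.
  split; first by apply/cvg_ex; exists 0.
  by apply/cvg_lim.
Unshelve. all: by end_near. Qed.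

Lemma Ck_on_flat n k m (U : set 'rV[R]_n) (g : 'rV[R]_n -> R) :
  open U -> Ck_on k U g -> Ck_on k U (fun x => flat m (g x)).
Proof.
move=> oU; elim: k m => [|k IH] m Cg.
  split=> // x Ux.
  have cg := Ck_on_cont Cg Ux.
  apply: continuous_comp cg _.
  apply/differentiable_continuous/derivable1_diffP.
  by have [] := is_derive_flat m (g x).
have D x j : U x -> is_derive x (delta_mx 0 j) (fun x => flat m (g x))
   ((flat m.+2 (g x) - m%:R * flat m.+1 (g x)) * 'D_(delta_mx 0 j) g x).
  move=> Ux.
  have dg := Ck_on_differentiable oU Cg Ux.
  have [df Df] := is_derive_flat m (g x).
  have {}df : differentiable (flat m) (g x) by apply/derivable1_diffP.
  have dfg : differentiable (flat m \o g) x by exact: differentiable_comp.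
  split; first by apply: diff_derivable; exact: dfg.
  rewrite (_ : (fun x => _) = flat m \o g)// deriveE// diff_comp//= -Df.
  rewrite !deriveE// mulrC -[RHS]/(_ *: _) -linearZ /=; congr ('d _ _ _).
  by rewrite /GRing.scale /= mulr1.
split.
  move=> x Ux; have cg := Ck_on_cont Cg Ux.
  apply: continuous_comp cg _.
  apply/differentiable_continuous/derivable1_diffP.
  by have [] := is_derive_flat m (g x).
move=> j; split=> [x Ux|]; first by have [] := D x j Ux.
have Cg' := Ck_onS Cg.
apply: (@Ck_on_ext R n k U (((fun x => flat m.+2 (g x)) +
    (cst (- m%:R)) * (fun x => flat m.+1 (g x))) *
    (fun x => 'D_(delta_mx 0 j) g x)) _ oU).
  by move=> x Ux; have [_ ->] := D x j Ux; rewrite !fctE /= mulNr.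
apply: Ck_onM => //; last by have [_ /(_ j)[]] := Cg.
apply: Ck_onD => //; first exact: IH.
by apply: Ck_onM => //; [exact: Ck_on_cst|exact: IH].
Qed.

Lemma Ck_on_prod n k (U : set 'rV[R]_n) m (F : 'I_m -> 'rV[R]_n -> R) :
  open U -> (forall i, Ck_on k U (F i)) -> Ck_on k U (fun x => \prod_i F i x).
Proof.
move=> oU CF; rewrite -fct_prodE.
apply: (big_ind (Ck_on k U)) => //; first exact: Ck_on_cst.
by move=> f g; exact: Ck_onM.
Qed.

(** The norm on rows is the maximum of the entries, so a product of one-variable
    bumps is supported in a ball. *)
Lemma exists_bump n (x0 : 'rV[R]_n) (r : R) : 0 < r ->
  exists psi : 'rV[R]_n -> R,
    [/\ smooth_on setT psi, psi x0 != 0 &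
        forall x, psi x != 0 -> `|x - x0| <= r].
Proof.
move=> r0.
exists (fun x => \prod_(l < n) flat 0 (r ^+ 2 - (x 0 l - x0 0 l) ^+ 2)); split.
- move=> k; apply: Ck_on_prod; first exact: openT.
  move=> l; apply: Ck_on_flat; first exact: openT.
  have Cl : Ck_on k setT ((fun x : 'rV[R]_n => x 0 l) + cst (- x0 0 l)).
    by apply: Ck_onD; [exact: openT|exact: Ck_on_coord|exact: Ck_on_cst].
  have := Ck_onD openT (@Ck_on_cst _ n k setT (r ^+ 2))
    (Ck_onM openT (@Ck_on_cst _ n k setT (-1)) (Ck_onM openT Cl Cl)).
  by congr Ck_on; apply/funext => x; rewrite !fctE /= mulN1r expr2.
- apply/prodf_neq0 => l _; rewrite subrr expr0n subr0 gt_eqF//.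
  by apply: flat_gt0; rewrite exprn_gt0.
- move=> x /prodf_neq0 H; apply: norm_le_coord => [|l]; first exact: ltW.
  have := H l isT; rewrite !mxE; apply: contraNT; rewrite -ltNge => rx.
  rewrite flat_eq0// subr_le0 -[leRHS]real_normK ?num_real//.
  by rewrite lerXn2r ?nnegrE// ltW.
Qed.

End Bump.

(** * Integrals over the unit interval depending on a parameter *)

Section Integral01.
Variable R : realType.
Implicit Types f g : R -> R.

(** Two-sided continuity, also at 0 and 1: every integrand below is defined and
    continuous around the interval. *)
Definition cont01 f := forall t : R, 0 <= t <= 1 -> {for t, continuous f}.

Definition int01 f : R := (\int[lebesgue_measure]_(t in `[0%R, 1%R]) f t)%R.

Lemma integrable01 f : cont01 f ->
  (@lebesgue_measure R).-integrable `[0%R, 1%R] (EFin \o f).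
Proof.
move=> cf; apply: continuous_compact_integrable; first exact: segment_compact.
apply: continuous_in_subspaceT => t; rewrite inE /= in_itv /=; exact: cf.
Qed.

Lemma cont01B f g : cont01 f -> cont01 g -> cont01 (fun t => f t - g t).
Proof. by move=> cf cg t t01; exact: (continuousB (cf t t01) (cg t t01)). Qed.

Lemma cont01D f g : cont01 f -> cont01 g -> cont01 (fun t => f t + g t).
Proof. by move=> cf cg t t01; exact: (continuousD (cf t t01) (cg t t01)). Qed.

Lemma cont01Z (c : R) f : cont01 f -> cont01 (fun t => c * f t).
Proof.
move=> cf t t01.
exact: (continuousM (@cst_continuous _ _ c t) (cf t t01)).
Qed.

Lemma int01B f g : cont01 f -> cont01 g ->
  int01 (fun t => f t - g t) = int01 f - int01 g.
Proof. by move=> cf cg; apply: RintegralB => //; exact: integrable01. Qed.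

Lemma int01D f g : cont01 f -> cont01 g ->
  int01 (fun t => f t + g t) = int01 f + int01 g.
Proof. by move=> cf cg; apply: RintegralD => //; exact: integrable01. Qed.

Lemma int01Z c f : cont01 f -> int01 (fun t => c * f t) = c * int01 f.
Proof. by move=> cf; apply: RintegralZl => //; exact: integrable01. Qed.

Lemma int01_cst (c : R) : int01 (fun=> c) = c.
Proof.
rewrite /int01 Rintegral_cst// -[RHS]mulr1; congr (_ * _).
rewrite -[RHS]/(fine 1%E); congr fine.
have := @lebesgue_measure_itv R `[0%R, 1%R]; rewrite /= lte_fin ltr01 sube0.
exact.
Qed.

Lemma eq_int01 f g : (forall t, 0 <= t <= 1 -> f t = g t) -> int01 f = int01 g.
Proof.
by move=> fg; apply: eq_Rintegral => t; rewrite inE /= in_itv /=; exact: fg.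
Qed.

Lemma cont01_cst c : cont01 (fun=> c).
Proof. by move=> t _; exact: cst_continuous. Qed.

Lemma int01_sum n (F : 'I_n -> R -> R) : (forall i, cont01 (F i)) ->
  cont01 (fun t => \sum_i F i t) /\
  int01 (fun t => \sum_i F i t) = \sum_i int01 (F i).
Proof.
move=> cF; elim: n F cF => [|n IH] F cF.
  rewrite big_ord0 -[RHS]int01_cst; split.
    by under eq_fun do rewrite big_ord0; exact: cont01_cst.
  by apply: eq_int01 => t _; rewrite big_ord0.
have [c e] := IH (fun i => F (lift ord0 i)) (fun i => cF _).
rewrite big_ord_recl -e -int01D//; under eq_fun do rewrite big_ord_recl.
by split => //; exact: cont01D.
Qed.

Lemma int01_le f (e : R) : cont01 f ->
  (forall t, 0 <= t <= 1 -> `|f t| <= e) -> `|int01 f| <= e.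
Proof.
move=> cf fe.
apply: le_trans (le_normr_Rintegral _ (integrable01 cf)) _ => //.
rewrite -[leRHS]int01_cst; apply: le_Rintegral => //.
- apply: (@integrable01 (fun t => `|f t|)) => t t01.
  exact: (continuous_comp (cf t t01) (@norm_continuous _ _ _)).
- by apply: integrable01; exact: cont01_cst.
Qed.

Lemma int01_derive (F f : R -> R) :
  (forall t : R, 0 <= t <= 1 -> is_derive t 1 F (f t)) -> cont01 f ->
  int01 f = F 1 - F 0.
Proof.
move=> dF cf.
have cF t : 0 <= t <= 1 -> {for t, continuous F}.
  by move=> /dF[d _]; apply/differentiable_continuous/derivable1_diffP.
rewrite /int01 /Rintegral (@continuous_FTC2 R f F 0 1) ?ltr01//.
- apply: continuous_in_subspaceT => t; rewrite inE /= in_itv /=; exact: cf.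
- split.
  + move=> t; rewrite in_itv /= => /andP[t0 t1].
    by have [] := dF t; rewrite ?(ltW t0) ?(ltW t1).
  + by apply: cvg_at_right_filter; apply: cF; rewrite lexx ler01.
  + by apply: cvg_at_left_filter; apply: cF; rewrite lexx ler01.
- move=> t; rewrite in_itv /= => /andP[t0 t1].
  by rewrite derive1E; have [] := dF t; rewrite ?(ltW t0) ?(ltW t1).
Qed.

Variable V : normedModType R.

(** Joint continuity gives a neighbourhood of (t, x) for each t; compactness of
    [0, 1] makes the neighbourhood of x independent of t. *)
Lemma near_param01 (H : R -> V -> R) (x : V) (e : R) : 0 < e ->
  (forall t : R, 0 <= t <= 1 ->
    {for (t, x), continuous (fun p : R * V => H p.1 p.2)}) ->
  \forall z \near x, forall t, 0 <= t <= 1 -> `|H t z - H t x| <= e.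
Proof.
move=> e0 cH.
have e20 : 0 < e / 2 by rewrite divr_gt0.
have /compact_near_coveringP := @segment_compact R 0 1.
move=> /(_ V (nbhs x) (fun z t => `|H t z - H t x| <= e) _) cov.
have {}cov : \forall z \near x, `[0, 1] `<=` (fun t => `|H t z - H t x| <= e).
  apply: cov => t; rewrite /= in_itv /= => /cH.
  move=> /cvgrPdist_le/(_ _ e20)[[A B] /= [nA nB] AB].
  exists (A, B) => //= -[s z] [/= As Bz].
  have h1 := AB (s, z) (conj As Bz).
  have h2 := AB (s, x) (conj As (nbhs_singleton nB)).
  rewrite /= in h1 h2; rewrite -(subrKA (H t x)) (splitr e).
  by apply: le_trans (ler_normD _ _) _; rewrite lerD// distrC.
by apply: filterS cov => z zH t t01; apply: zH; rewrite /= in_itv.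
Qed.

Section Param.
Variables (B : set V) (H : R -> V -> R).
Hypothesis oB : open B.
Hypothesis cH : forall (t : R) x, 0 <= t <= 1 -> B x ->
    {for (t, x), continuous (fun p : R * V => H p.1 p.2)}.

Lemma cont01_param x : B x -> cont01 (H^~ x).
Proof.
move=> Bx t t01.
apply: (@continuous_comp _ _ _ (fun t => (t, x)) (fun p : R * V => H p.1 p.2)).
  exact: (cvg_pair cvg_id (cvg_cst _)).
exact: cH.
Qed.

Lemma continuous_param x : B x -> {for x, continuous (fun z => int01 (H^~ z))}.
Proof.
move=> Bx; apply/cvgrPdist_le => e e0.
have N := near_param01 e0 (fun t t01 => cH t01 Bx).
near=> z.
have Bz : B z by near: z; exact: open_nbhs_nbhs.
rewrite -int01B; [|exact: cont01_param..].
apply: int01_le; first by apply: cont01B; exact: cont01_param.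
by move=> t t01; rewrite distrC; move: t t01; near: z; exact: N.
Unshelve. all: by end_near. Qed.

(** By the mean value theorem, the difference quotients of the integrand are as
    close to H' t x as the values of H' t near x, uniformly in t. *)
Lemma derive_param (H' : R -> V -> R) x v : B x ->
  (forall (t : R) x, 0 <= t <= 1 -> B x ->
    {for (t, x), continuous (fun p : R * V => H' p.1 p.2)}) ->
  (forall (t : R) x, 0 <= t <= 1 -> B x -> is_derive x v (H t) (H' t x)) ->
  is_derive x v (fun z => int01 (H^~ z)) (int01 (H'^~ x)).
Proof.
move=> Bx cH' dH.
have cx : cont01 (H^~ x) by exact: cont01_param.
have cx' : cont01 (H'^~ x).
  move=> t t01.
  apply: (@continuous_comp _ _ _ (fun t => (t, x)) (fun p : R * V => H' p.1 p.2)).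
    exact: (cvg_pair cvg_id (cvg_cst _)).
  exact: cH'.
suff L : (fun h : R => h^-1 *: (((fun z => int01 (H^~ z)) \o shift x) (h *: v)
   - int01 (H^~ x))) @ 0^' --> int01 (H'^~ x).
  by split; [apply/cvg_ex; exists (int01 (H'^~ x))|exact/cvg_lim].
apply/cvgrPdist_le => e e0.
have : \forall z \near x, B z /\
    forall t, 0 <= t <= 1 -> `|H' t z - H' t x| <= e.
  apply: filterS2 (open_nbhs_nbhs (conj oB Bx))
    (near_param01 e0 (fun t t01 => cH' t _ t01 Bx)) => z; by split.
move=> /nbhs_ballP[d d0 Bd].
near=> h.
have h0 : h != 0 by near: h; exact: nbhs_dnbhs_neq.
have hd (s : R) : `|s| <= `|h| -> ball x d (x + s *: v).
  move=> sh; rewrite -ball_normE /= opprD addNKr normrN normrZ.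
  apply: le_lt_trans (_ : _ <= `|h| * (`|v| + 1)) _.
    by apply: ler_pM => //; rewrite lerDl.
  rewrite -ltr_pdivlMr ?ltr_wpDl//.
  by near: h; apply: dnbhs0_lt; rewrite divr_gt0 ?ltr_wpDl.
have [Bh _] := Bd _ (hd h (lexx _)).
have ch : cont01 (H^~ (x + h *: v)) by exact: cont01_param.
rewrite /= (addrC _ x) -int01B// -[_ *: int01 _]/(_ * _).
have cq : cont01 (fun t => H t (x + h *: v) - H t x) by exact: cont01B.
rewrite -int01Z// -int01B//; last exact: cont01Z.
apply: int01_le; first by apply: cont01B => //; exact: cont01Z.
move=> t t01; rewrite distrC.
rewrite -(ler_pM2l (_ : 0 < `|h|)) ?normr_gt0// -normrM mulrBr mulVKf// [leRHS]mulrC.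
apply: mvt_line => s sh; have [Bs He] := Bd _ (hd s sh).
by have [dHs ->] := dH t _ t01 Bs; split => //; exact: He.
Unshelve. all: by end_near. Qed.

End Param.
End Integral01.

(** * Hadamard's lemma *)

Section Hadamard.
Variables (R : realType) (n : nat) (x0 : 'rV[R]_n) (B : set 'rV[R]_n).
Hypothesis oB : open B.
Local Notation seg := (fun (t : R) (x : 'rV[R]_n) => x0 + t *: (x - x0)).
Hypothesis starB : forall t x, 0 <= t <= 1 -> B x -> B (seg t x).
Implicit Types F f : 'rV[R]_n -> R.

(** The case m = 0 is the integral in Hadamard's formula; differentiating it with
    respect to x brings out a factor t, whence the powers of t. *)
Definition moment (m : nat) F (x : 'rV[R]_n) : R :=
  int01 (fun t => t ^+ m * F (x0 + t *: (x - x0))).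

Lemma continuous_seg (t : R) (x : 'rV[R]_n) :
  {for (t, x), continuous (fun p : R * 'rV[R]_n => seg p.1 p.2)}.
Proof.
apply: cvgD; first exact: cvg_cst.
apply: cvgZ; first exact: cvg_fst.
by apply: cvgB; [exact: cvg_snd|exact: cvg_cst].
Qed.

Lemma continuous_moment m F t x : (forall y, B y -> {for y, continuous F}) ->
  0 <= t <= 1 -> B x ->
  {for (t, x), continuous (fun p : R * 'rV[R]_n => p.1 ^+ m * F (seg p.1 p.2))}.
Proof.
move=> cF t01 Bx.
have c1 : {for (t, x), continuous (fun p : R * 'rV[R]_n => p.1 ^+ m)}.
  apply: (@continuous_comp _ _ _ (fun p : R * 'rV[R]_n => p.1) (fun s => s ^+ m)).
    exact: cvg_fst.
  exact: exprn_continuous.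
have c2 : {for (t, x), continuous (fun p : R * 'rV[R]_n => F (seg p.1 p.2))}.
  apply: (@continuous_comp _ _ _ (fun p : R * 'rV[R]_n => seg p.1 p.2) F).
    exact: continuous_seg.
  by apply: cF; exact: starB.
exact: (continuousM c1 c2).
Qed.

Lemma is_derive_seg F t x v : differentiable F (seg t x) ->
  is_derive x v (fun z => F (seg t z)) (t * 'D_v F (seg t x)).
Proof.
move=> dF.
have e : (fun h : R => h^-1 *: (((fun z => F (seg t z)) \o shift x) (h *: v)
            - F (seg t x)))
       = (fun h : R => h^-1 *: ((F \o shift (seg t x)) (h *: (t *: v))
            - F (seg t x))).
  apply/funext => h /=; congr (_ *: (F _ - _)).
  by rewrite -addrA scalerDr addrCA scalerA mulrC -scalerA.
have : derivable F (seg t x) (t *: v) by exact: diff_derivable.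
rewrite /derivable -e => D; split=> //.
have -> : 'D_v (fun z => F (seg t z)) x = 'D_(t *: v) F (seg t x).
  by rewrite /derive e.
by rewrite !deriveE// linearZ.
Qed.

(** The partial derivatives of [moment m F] are [moment m.+1] of those of F. *)
Lemma Ck_on_moment k m F : smooth_on B F -> Ck_on k B (moment m F).
Proof.
elim: k m F => [|k IH] m F sF.
  split=> // x Bx; apply: (continuous_param oB) => // t z t01 Bz.
  by apply: continuous_moment => // y; exact: Ck_on_cont (sF 0).
split.
  move=> x Bx; apply: (continuous_param oB) => // t z t01 Bz.
  by apply: continuous_moment => // y; exact: Ck_on_cont (sF 0).
move=> j.
have sDF : smooth_on B (fun x => 'D_(delta_mx 0 j) F x).
  exact: smooth_on_derive.
have D x : B x -> is_derive x (delta_mx 0 j) (moment m F)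
    (moment m.+1 (fun x => 'D_(delta_mx 0 j) F x) x).
  move=> Bx; apply: (@derive_param R _ B (fun t x => t ^+ m * F (seg t x)) oB _
    (fun t x => t ^+ m.+1 * 'D_(delta_mx 0 j) F (seg t x)) x (delta_mx 0 j) Bx).
  - by move=> t z t01 Bz; apply: continuous_moment => // y; exact: Ck_on_cont (sF 0).
  - by move=> t z t01 Bz; apply: (@continuous_moment m.+1 (fun x => 'D_(delta_mx 0 j) F x)) => // y;
    exact: Ck_on_cont (sDF 0).
  - move=> t z t01 Bz.
    have dF : differentiable F (seg t z).
      by apply: Ck_on_differentiable oB (sF 1) _; exact: starB.
    have := is_deriveZ (t ^+ m) (is_derive_seg (delta_mx 0 j) dF).
    by move/is_derive_eq; apply; rewrite exprSr -mulrA.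
split; first by move=> x /D[].
apply: (@Ck_on_ext R n k B (moment m.+1 (fun x => 'D_(delta_mx 0 j) F x)) _ oB).
  by move=> x /D[_ ->].
exact: IH.
Qed.

(** f x - f x0 is the integral of the derivative of f along the segment from x0
    to x, which is linear in x - x0 with the integrals of the partial derivatives
    as coefficients. *)
Lemma hadamard f : smooth_on B f ->
  exists g : 'I_n -> 'rV[R]_n -> R,
    [/\ forall l, smooth_on B (g l),
        forall l, g l x0 = 'D_(delta_mx 0 l) f x0 &
        forall x, B x -> f x = f x0 + \sum_l (x 0 l - x0 0 l) * g l x].
Proof.
move=> sf; exists (fun l => moment 0 (fun x => 'D_(delta_mx 0 l) f x)); split.
- by move=> l k; apply: Ck_on_moment; exact: smooth_on_derive.
- move=> l; rewrite /moment -[RHS]int01_cst; apply: eq_int01 => t _.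
  by rewrite subrr scaler0 addr0 expr0 mul1r.
- move=> x Bx.
  have cD l : cont01 (fun t => t ^+ 0 * 'D_(delta_mx 0 l) f (seg t x)).
    apply: (@cont01_param R _ B (fun t x => t ^+ 0 * 'D_(delta_mx 0 l) f (seg t x)))
      => // t z t01 Bz.
    apply: (@continuous_moment 0 (fun x => 'D_(delta_mx 0 l) f x)) => // y.
    exact: Ck_on_cont (smooth_on_derive l sf 0).
  have [c e] := int01_sum (fun l => @cont01Z R (x 0 l - x0 0 l) _ (cD l)).
  rewrite /moment; under eq_bigr do rewrite -(int01Z _ (cD _)).
  have dS (t : R) : 0 <= t <= 1 -> is_derive t 1 (fun t => f (seg t x))
      (\sum_l (x 0 l - x0 0 l) * (t ^+ 0 * 'D_(delta_mx 0 l) f (seg t x))).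
    move=> t01; have dF : differentiable f (seg t x).
      by apply: Ck_on_differentiable oB (sf 1) _; exact: starB.
    have := is_derive_line (@diff_derivable _ _ _ _ _ (x - x0) dF).
    move/is_derive_eq; apply.
    rewrite derive_partial//; apply: eq_bigr => l _.
    by rewrite !mxE expr0 mul1r.
  by rewrite -e (int01_derive dS c) scale1r scale0r addr0 (addrC x0) subrK addrC subrK.
Qed.

End Hadamard.

(** * Extension by zero and local frames of vector fields *)

Section ExtendByZero.
Variables (R : realType) (n : nat) (M : manifold R n) (i : cindex M).
Local Notation V := (chart i @` cdom i).

Lemma codom_param x : V x -> cdom i (@param _ _ M i x) /\ chart i (@param _ _ M i x) = x.
Proof. by move=> [q iq <-]; rewrite chartK. Qed.

(** Outside of the domain, the value of [chart i] is arbitrary, so the domain is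
    tested explicitly. *)
Definition ext0 (u : 'rV[R]_n -> R) (q : M) : R :=
  if `[< cdom i q >] then u (chart i q) else 0.

Lemma ext0E u q : cdom i q -> ext0 u q = u (chart i q).
Proof. by move=> iq; rewrite /ext0 asboolT. Qed.

(** In any other chart, two open sets cover: the part of chart i over B, where
    the function is u composed with a transition map, and the complement of the
    image of K, where it vanishes.  That image is closed since M is Hausdorff.
    Smoothness of u is asked on B only, because the functions given by Hadamard's
    lemma are defined on a cube. *)
Lemma smooth_ext0 (B K : set 'rV[R]_n) (u : 'rV[R]_n -> R) :
  open B -> B `<=` V -> compact K -> K `<=` B -> smooth_on B u ->
  (forall x, u x != 0 -> K x) -> smooth (ext0 u).
Proof.
move=> oB BV cK KB su uK j.
pose S : set M := @param _ _ M i @` K.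
have clS : closed S.
  apply: compact_closed; first exact: m_hausdorff.
  apply: continuous_compact => //.
  apply: continuous_in_subspaceT => x; rewrite inE => Kx.
  exact/param_continuous/BV/KB.
pose W := chart j @` cdom j.
have oW : open W by exact: ccod_open.
pose O : set M := [set q | cdom i q /\ B (chart i q)].
have oO : open O.
  rewrite openE => q [iq Bq]; apply: filterI.
    exact: open_nbhs_nbhs (conj (cdom_open i) iq).
  by apply: (chart_continuous iq); exact: open_nbhs_nbhs.
pose U (A : set M) : set 'rV[R]_n := [set x | W x /\ A (@param _ _ M j x)].
have oU A : open A -> open (U A).
  move=> oA; rewrite openE => x [Wx Ax]; apply: filterI.
    exact: open_nbhs_nbhs.
  by apply: (param_continuous Wx); exact: open_nbhs_nbhs.
have oU2 := oU _ (closed_openC clS).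
have WU : W `<=` U O `|` U (~` S).
  move=> x Wx; have [[k Kk kx]|nS] := EM (S (@param _ _ M j x)); last by right.
  have [ik ck] := codom_param (BV _ (KB _ Kk)).
  by left; split=> //; rewrite -kx; split=> //; rewrite ck; exact: KB.
move=> k; apply: Ck_onW WU _; apply: Ck_onU.
- apply: (@Ck_on_ext _ _ k _ (u \o (fun x => chart i (@param _ _ M j x)))).
  + exact: oU.
  + by move=> x [_ [ix _]]; rewrite /= ext0E.
  + apply: (@Ck_on_comp _ _ _ _ _ B) => //; [exact: oU| |by move=> x [_ []]].
    move=> l; apply: Ck_onW (@transition_smooth _ _ M j i l k) => x [[q jq <-]].
    by rewrite chartK// => -[iq _]; exists q.
- apply: (@Ck_on_ext _ _ k _ (fun=> 0)) => //; last exact: Ck_on_cst.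
  move=> x [_ nS]; rewrite /= /ext0; case: asboolP => // iq.
  apply/esym/eqP; apply/negPn/negP => /uK Kq; apply: nS.
  by exists (chart i (@param _ _ M j x)) => //; rewrite chartK.
Qed.

End ExtendByZero.

Section FunctionRing.
Variables (R : realType) (n : nat) (M : manifold R n).
Local Notation C := (cfun M).
Local Notation VF := (vfield M).
Implicit Types (f g : C) (X : VF) (q : M).

Lemma cfunD f g q : (f + g) q = f q + g q. Proof. by []. Qed.
Lemma cfunM f g q : (f * g) q = f q * g q. Proof. by []. Qed.
Lemma cfunN f q : (- f) q = - f q. Proof. by []. Qed.
Lemma cfunX f k q : (f ^+ k) q = f q ^+ k.
Proof. by elim: k => [//|k IH]; rewrite !exprS cfunM IH. Qed.
Lemma cfun_sum (I : finType) (F : I -> C) q : (\sum_l F l) q = \sum_l F l q.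
Proof. by apply: (big_morph (fun f : C => f q)). Qed.

Lemma cfun_ext f g : (forall q, f q = g q) -> f = g.
Proof. by move=> fg; apply/val_inj/funext. Qed.

Lemma vfield0 X : X 0 = 0 :> C.
Proof. by apply: (@addrI C (X 0)); rewrite -vfieldD !addr0. Qed.

Lemma vfieldN X f : X (- f) = - X f :> C.
Proof. by apply/eqP; rewrite -addr_eq0 -vfieldD addNr vfield0. Qed.

Lemma vfieldB X f g : X (f - g) = X f - X g :> C.
Proof. by rewrite vfieldD vfieldN. Qed.

(** R-linearity reduces this to X 1 = 0, which is Leibniz' rule for 1 = 1 * 1. *)
Lemma vfield_cst X (a : R) : X (ccst M a) = 0 :> C.
Proof.
have X1 : X 1 = 0 :> C.
  by apply: (@addrI C (X 1)); rewrite addr0 -{3}(mulr1 1) vfieldM !mul1r.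
by have := vfield_linear X a 1 0; rewrite mulr1 addr0 X1 vfield0 mulr0 addr0.
Qed.

Lemma vfield_sumr X m (F : 'I_m -> C) : X (\sum_l F l) = \sum_l X (F l) :> C.
Proof. by apply: (big_morph (X : C -> C)); [exact: vfieldD|exact: vfield0]. Qed.

Lemma vfield_suml m (F : 'I_m -> VF) f : (\sum_l F l) f = \sum_l F l f :> C.
Proof. by apply: (big_morph (fun X : VF => X f : C)). Qed.

Lemma vfieldDl X (Y : VF) f : (X + Y) f = X f + Y f :> C. Proof. by []. Qed.
Lemma vfieldNl X f : (- X) f = - X f :> C. Proof. by []. Qed.
Lemma vfieldZl h X f : (h *: X) f = h * X f :> C. Proof. by []. Qed.

Lemma vfield_ext X (Y : VF) : (forall f, X f = Y f :> C) -> X = Y.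
Proof. by move=> XY; apply/val_inj/funext. Qed.

End FunctionRing.

Section LocalFrame.
Variables (R : realType) (n : nat) (M : manifold R n).
Local Notation C := (cfun M).
Local Notation VF := (vfield M).

(** The balls of the maximum norm are cubes; what matters is that they are
    convex. *)
Lemma exists_chart_cube (p : M) : exists (i : cindex M) (r : R),
  [/\ 0 < r, cdom i p & ball (chart i p) r `<=` chart i @` cdom i].
Proof.
have [i ip] := cdom_cover p; exists i.
have Vp : (chart i @` cdom i) (chart i p) by exists p.
have /nbhs_ballP[r /= r0 rV] := open_nbhs_nbhs (conj (@ccod_open _ _ M i) Vp).
by exists r.
Qed.

Section Frame.
Variables (i : cindex M) (c0 : 'rV[R]_n) (r : R) (psi : 'rV[R]_n -> R).
Hypothesis r0 : 0 < r.
Local Notation B := (ball c0 r).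
Local Notation V := (chart i @` cdom i).
Hypothesis BV : B `<=` V.
Hypothesis spsi : smooth_on setT psi.
Hypothesis psiK : forall x, psi x != 0 -> `|x - c0| <= r / 2.

Lemma open_cube : open B.
Proof. exact: ball_open. Qed.

Lemma star_cube (x0 : 'rV[R]_n) t x : B x0 -> 0 <= t <= 1 -> B x ->
  B (x0 + t *: (x - x0)).
Proof.
rewrite -ball_normE /= => B0 /andP[t0 t1] Bx.
rewrite (_ : c0 - _ = (1 - t) *: (c0 - x0) + t *: (c0 - x)); last first.
  by apply/rowP => l; rewrite !mxE; ring.
apply: le_lt_trans (ler_normD _ _) _; rewrite !normrZ (ger0_norm t0).
rewrite ger0_norm ?subr_ge0//.
have [->|tn] := eqVneq t 0; first by rewrite subr0 mul1r mul0r addr0.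
rewrite [ltRHS](_ : r = (1 - t) * r + t * r); last by ring.
rewrite ler_ltD//; first by rewrite ler_wpM2l ?subr_ge0// ltW.
by rewrite ltr_pM2l// lt_def tn.
Qed.

Lemma smooth_cutoff u : smooth_on B u -> smooth (ext0 i (fun x => psi x * u x)).
Proof.
move=> su; apply: (@smooth_ext0 _ _ M i B (closed_ball c0 (r / 2))) => //.
- exact: open_cube.
- rewrite closed_ballE ?divr_gt0//.
  apply: bounded_closed_compact; last first.
    by rewrite -closed_ballE ?divr_gt0//; exact: closed_ball_closed.
  exists (`|c0| + r / 2); split; first exact: num_real.
  move=> a /= lta x /= xr; apply: le_trans (ltW lta).
  rewrite -(subrK c0 x) addrC; apply: le_trans (ler_normD _ _) _.
  by rewrite lerD2l distrC.
- rewrite closed_ballE ?divr_gt0// => x /= xr; rewrite -ball_normE /=.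
  by apply: le_lt_trans xr _; rewrite ltr_pdivrMr// ltr_pMr// ltr1n.
- move=> k; apply: Ck_onM; [exact: open_cube| |exact: su].
  by apply: Ck_onW (spsi k).
- move=> x; rewrite mulf_eq0 negb_or => /andP[/psiK xr _].
  by rewrite closed_ballE ?divr_gt0//; move: xr; rewrite distrC.
Qed.

(** The global function that equals psi u in the chart. *)
Definition cutoff u (su : smooth_on B u) : C :=
  CFun (mem_set (smooth_cutoff su) : _ \in @smooth_pred _ _ M).

Lemma cutoffE u (su : smooth_on B u) q : cdom i q ->
  cutoff su q = psi (chart i q) * u (chart i q).
Proof. by move=> iq; rewrite /= ext0E. Qed.

Lemma cutoffNE u (su : smooth_on B u) q : ~ cdom i q -> cutoff su q = 0.
Proof. by move=> iq; rewrite /= /ext0 asboolF. Qed.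

Lemma cutoff_cube u (su : smooth_on B u) q : cdom i q -> ~ B (chart i q) ->
  cutoff su q = 0.
Proof.
move=> iq nB; rewrite cutoffE// (_ : psi _ = 0) ?mul0r//.
apply/eqP; apply: contra_notT nB => /psiK xr; rewrite -ball_normE /= distrC.
by apply: le_lt_trans xr _; rewrite ltr_pdivrMr// ltr_pMr// ltr1n.
Qed.

Definition in_chart (f : C) : 'rV[R]_n -> R := fun x => f (@param _ _ M i x).

Lemma smooth_in_chart (f : C) : smooth_on V (in_chart f).
Proof. by have := cfunP f; rewrite inE => /(_ i). Qed.

Lemma smooth_partial (f : C) l :
  smooth_on B (fun x => 'D_(delta_mx 0 l) (in_chart f) x).
Proof.
by move=> k; apply: Ck_onW BV _; exact: (smooth_on_derive l (smooth_in_chart f) k).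
Qed.

Lemma frame_subproof l :
  (fun f => cutoff (smooth_partial f l) : C^o) \in @derivation_pred _ _ M.
Proof.
rewrite inE; split=> [a f g|f g]; apply: cfun_ext => q.
- rewrite cfunD cfunM.
  have [iq|iq] := EM (cdom i q); last by rewrite !cutoffNE// mulr0 addr0.
  have Vq : V (chart i q) by exists q.
  have df := @smooth_on_derivable R n V (in_chart f) l _ (smooth_in_chart f) Vq.
  have dg := @smooth_on_derivable R n V (in_chart g) l _ (smooth_in_chart g) Vq.
  have [_ D] := is_deriveD (is_deriveZ a (derivableP df)) (derivableP dg).
  rewrite !cutoffE// (_ : in_chart _ = a *: in_chart f + in_chart g)// D mulrDr mulrCA.
  by [].
- rewrite cfunD !cfunM.
  have [iq|iq] := EM (cdom i q); last by rewrite !cutoffNE// !mulr0 addr0.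
  have Vq : V (chart i q) by exists q.
  have df := @smooth_on_derivable R n V (in_chart f) l _ (smooth_in_chart f) Vq.
  have dg := @smooth_on_derivable R n V (in_chart g) l _ (smooth_in_chart g) Vq.
  have [_ D] := is_deriveM (derivableP df) (derivableP dg).
  have E h : in_chart h (chart i q) = h q by rewrite /in_chart chartK.
  rewrite !cutoffE// (_ : in_chart _ = in_chart f * in_chart g)// D !E /GRing.scale /=; ring.
Qed.

(** The coordinate field of index l, multiplied by psi. *)
Definition frame l : VF := VField (frame_subproof l).

Lemma smooth1 : smooth_on B (fun=> 1).
Proof. by move=> k; exact: Ck_on_cst. Qed.

Lemma smooth_coord l : smooth_on B (fun x => x 0 l).
Proof. by move=> k; exact: Ck_on_coord. Qed.

Let Psi := cutoff smooth1.
Let Y l := cutoff (smooth_coord l).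

(** Let x0 be the coordinates of a point q of the cube.  Hadamard's lemma at x0,
    multiplied by psi^2, is an identity between global functions,
      psi^2 (f - f q) = sum_l (psi x_l - (x0)_l psi) (psi g_l).
    Apply X and evaluate at q: the factors f - f q and psi x_l - (x0)_l psi vanish
    there, so only their derivatives by X remain, and psi g_l becomes the value of
    [frame l] on f.  One more factor psi replaces (x0)_l psi by Y l, which does
    not depend on q.  Cutting the coordinates off by the same psi makes a second
    bump function, equal to 1 on the support of the first, unnecessary. *)
Lemma frameP (X : VF) :
  Psi ^+ 3 *: X = \sum_l (Psi * X (Y l) - Y l * X Psi) *: frame l.
Proof.
apply: vfield_ext => f; apply: cfun_ext => q.
rewrite vfieldZl cfunM cfunX vfield_suml cfun_sum.
have off : Psi q = 0 -> (forall l, frame l f q = 0) ->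
    Psi q ^+ 3 * (X f : C) q =
    \sum_l (((Psi * X (Y l) - Y l * X Psi) *: frame l) f : C) q.
  move=> -> fr0; rewrite expr0n mul0r big1// => l _.
  by rewrite vfieldZl cfunM fr0 mulr0.
have [iq|iq] := EM (cdom i q); last first.
  by apply: off => [|l]; rewrite ?[LHS]cutoffNE.
have [Bq|Bq] := EM (B (chart i q)); last first.
  by apply: off => [|l]; rewrite ?[LHS]cutoff_cube.
set x0 := chart i q.
have sfB : smooth_on B (in_chart f) by move=> k; apply: Ck_onW BV (smooth_in_chart f k).
have [g [sg g0 fg]] := hadamard open_cube (fun t x => star_cube Bq) sfB.
pose G l := cutoff (sg l).
have key : Psi ^+ 2 * (f - ccst M (f q)) =
    \sum_l (Y l - ccst M (x0 0 l) * Psi) * G l.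
  apply: cfun_ext => q'; rewrite cfunM cfunX cfunD cfunN cfun_sum.
  have [iq'|iq'] := EM (cdom i q'); last first.
    rewrite [Psi q']cutoffNE// expr0n mul0r big1// => l _.
    by rewrite cfunM [G l q']cutoffNE// mulr0.
  have [Bq'|Bq'] := EM (B (chart i q')); last first.
    rewrite [Psi q']cutoff_cube// expr0n mul0r big1// => l _.
    by rewrite cfunM [G l q']cutoff_cube// mulr0.
  have := fg _ Bq'; rewrite /in_chart !chartK// => ->.
  rewrite -[ccst M (f q) q']/(f q) (addrC (f q)) addrK mulr_sumr.
  apply: eq_bigr => l _.
  rewrite cfunM cfunD cfunN cfunM [Psi q']cutoffE// [G l q']cutoffE// [Y l q']cutoffE//.
  by rewrite -[ccst M (x0 0 l) q']/(x0 0 l) /x0; ring.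
have := congr1 (fun h : C => (X h : C) q) key.
rewrite vfieldM vfieldB vfield_cst subr0 cfunD cfunM cfunX (cfunM (f - _)).
rewrite [X in _ + X * _ = _](_ : _ = 0) ?mul0r ?addr0; last by rewrite cfunD cfunN subrr.
move=> E; rewrite exprS -mulrA E vfield_sumr cfun_sum mulr_sumr.
apply: eq_bigr => l _.
rewrite vfieldM vfieldB vfieldM vfield_cst mulr0 addr0 vfieldZl.
rewrite !(cfunD, cfunM, cfunN) [Psi q]cutoffE// [Y l q]cutoffE// [G l q]cutoffE// g0.
rewrite [frame l f q]cutoffE//.
rewrite -[ccst M (x0 0 l) q]/(x0 0 l) /x0; ring.
Qed.

End Frame.

(** The coefficients are the values on X of the 1-forms psi d(Y l) - Y l d psi. *)
Lemma local_frame (p : M) : exists (psi : C) (Y : 'I_n -> C) (e : 'I_n -> VF),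
  psi p != 0 /\ forall X : VF,
    psi ^+ 3 *: X = \sum_l (psi * X (Y l) - Y l * X psi) *: e l.
Proof.
have [i [r [r0 ip BV]]] := exists_chart_cube p.
have [psi [spsi psi0 psiK]] := exists_bump (chart i p) (divr_gt0 r0 (ltr0n R 2)).
exists (cutoff r0 BV spsi psiK (@smooth1 _ _)),
  (fun l => cutoff r0 BV spsi psiK (@smooth_coord _ _ l)),
  (frame r0 BV spsi psiK); split; last exact: frameP.
by rewrite cutoffE// mulr1.
Qed.

End LocalFrame.

(** * Alternating forms of top degree *)

Section TopForms.
Variables (R : realType) (n : nat) (M : manifold R n).
Local Notation C := (cfun M).
Local Notation VF := (vfield M).
Implicit Types (v w : 'I_n -> VF).

(** F is a function rather than a [topform], so that the results apply to linear
    combinations of two forms. *)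
Section Alternating.
Variables (F : ('I_n -> VF) -> C).
Hypothesis Flin : forall v i (f : C) (X Y : VF),
  F [eta v with i |-> f *: X + Y] =
  f * F [eta v with i |-> X] + F [eta v with i |-> Y].
Hypothesis Falt : forall v (i j : 'I_n), i != j -> v i = v j -> F v = 0.

Lemma eta_with_id v (i : 'I_n) : [eta v with i |-> v i] = v :> ('I_n -> VF).
Proof. by apply/funext => k /=; case: eqP => [->|]. Qed.

Lemma form_lin0 v i : F [eta v with i |-> 0] = 0.
Proof.
have := Flin v i 1 0 0; rewrite scaler0 addr0 mul1r => E.
by apply: (@addrI _ (F [eta v with i |-> 0])); rewrite -E addr0.
Qed.

Lemma form_linZ v i f X : F [eta v with i |-> f *: X] = f * F [eta v with i |-> X].
Proof. by rewrite -[f *: X]addr0 Flin form_lin0 addr0. Qed.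

Lemma form_linD v i X Y :
  F [eta v with i |-> X + Y] = F [eta v with i |-> X] + F [eta v with i |-> Y].
Proof. by have := Flin v i 1 X Y; rewrite scale1r mul1r. Qed.

Lemma form_lin_sum v i m (a : 'I_m -> C) (e : 'I_m -> VF) :
  F [eta v with i |-> \sum_l a l *: e l] = \sum_l a l * F [eta v with i |-> e l].
Proof.
elim: m a e => [|m IH] a e; first by rewrite !big_ord0 form_lin0.
by rewrite !big_ord_recl Flin IH.
Qed.

Lemma form_swap v (i j : 'I_n) : i != j -> F (v \o tperm i j) = - F v.
Proof.
move=> ij.
pose u X Y : 'I_n -> VF := [eta [eta v with i |-> X] with j |-> Y].
have uC X Y : u X Y = [eta [eta v with j |-> Y] with i |-> X].
  apply/funext => k; rewrite /u /=.
  by case: (eqVneq k j) => [->|//]; rewrite eq_sym (negPf ij).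
have z X : F (u X X) = 0.
  by apply: (@Falt _ i j) => //; rewrite /u /= !eqxx (negPf ij).
have uDr X Y Z : F (u X (Y + Z)) = F (u X Y) + F (u X Z) by exact: form_linD.
have uDl X Y Z : F (u (X + Y) Z) = F (u X Z) + F (u Y Z).
  by rewrite !uC; exact: form_linD.
have := z (v i + v j); rewrite uDl !uDr !z add0r addr0 => /eqP.
rewrite addr_eq0 => /eqP E.
have e1 : v \o tperm i j = u (v j) (v i).
  apply/funext => k; rewrite /u /=.
  case: tpermP => [->|->|/eqP/negPf ki /eqP/negPf kj].
  - by rewrite (negPf ij) eqxx.
  - by rewrite eqxx.
  - by rewrite ki kj.
have e2 : u (v i) (v j) = v.
  by apply/funext => k; rewrite /u /=; case: eqP => [->//|_]; case: eqP => [->|].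
by rewrite e1 -[in RHS]e2 E opprK.
Qed.

Variables (p : M) (h : C) (e : 'I_n -> VF).
Hypothesis hp : h p != 0.
Hypothesis span : forall X, exists a : 'I_n -> C, h *: X = \sum_l a l *: e l.

(** A permutation is a product of transpositions, which only change the sign. *)
Lemma form_perm0 v (s : 'S_n) : F v p = 0 -> F (v \o s) p = 0.
Proof.
have [ts -> _] := prod_tpermP s; move=> Fv0.
elim: ts => [|t ts IH].
  by rewrite big_nil (_ : v \o _ = v)//; apply/funext => k /=; rewrite perm1.
rewrite big_cons; set q := (\prod_(t <- ts) _)%g in IH *.
rewrite (_ : v \o _ = (v \o q) \o tperm t.1 t.2); last first.
  by apply/funext => k /=; rewrite permM.
have [->|t12] := eqVneq t.1 t.2.
  by rewrite (_ : _ \o _ = v \o q)//; apply/funext => k /=; rewrite tperm1 perm1.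
by rewrite form_swap// cfunN IH oppr0.
Qed.

(** By multilinearity h v_k can be replaced by its expansion in the e_l, one index
    k at a time, until every entry is some e_l; then F vanishes at p, either
    because an e_l is repeated or by [form_perm0].  Working at the point p allows
    the factors h to be cancelled. *)
Lemma form_vanish : F e p = 0 -> forall v, F v p = 0.
Proof.
move=> Fe0.
have base (f : 'I_n -> 'I_n) : F (e \o f) p = 0.
  have [/injectiveP fi|] := boolP (injectiveb f).
    rewrite (_ : e \o f = e \o perm fi); first exact: form_perm0.
    by apply/funext => k /=; rewrite permE.
  by case/injectivePn => i [j ij fij]; rewrite (@Falt _ i j)//= fij.
(* k is the number of leading entries that are still arbitrary. *)
have ind k : (k <= n)%N -> forall v,
    (forall j : 'I_n, (k <= j)%N -> exists l, v j = e l) -> F v p = 0.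
  elim: k => [|k IH] kn v vj.
    have /choice[f fE] : forall j : 'I_n, exists l, v j = e l by move=> j; exact: vj.
    by rewrite (_ : v = e \o f)//; exact/funext.
  pose i := Ordinal kn.
  have [a ha] := span (v i).
  have : (h * F v) p = 0.
    rewrite -{1}(eta_with_id v i) -form_linZ ha form_lin_sum cfun_sum big1// => l _.
    rewrite cfunM IH ?mulr0//; first exact: ltnW.
    move=> j kj /=; case: eqVneq => [_|ji]; first by exists l.
    apply: vj; rewrite ltn_neqAle kj andbT eq_sym.
    by apply: contraNneq ji => jk; apply/eqP/val_inj.
  by move/eqP; rewrite cfunM mulf_eq0 (negPf hp) /= => /eqP.
by move=> v; apply: (ind n) => // j; rewrite leqNgt ltn_ord.
Qed.

End Alternating.

(** With e a local frame at p, the form mu'(e) mu - mu(e) mu' vanishes on e, hence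
    everywhere at p; and mu'(e) is nonzero at p, for otherwise mu' would vanish
    at p. *)
Lemma volume_rank1 (mu mu' : volume_form M) v w :
  mu v * mu' w = mu' v * mu w.
Proof.
apply: cfun_ext => p; rewrite !cfunM.
have [psi [Y [e [psip fr]]]] := local_frame p.
have h3 : (psi ^+ 3) p != 0 by rewrite cfunX expf_neq0.
have span X : exists a : 'I_n -> C, psi ^+ 3 *: X = \sum_l a l *: e l.
  by exists (fun l => psi * X (Y l) - Y l * X psi); exact: fr.
have e0 : mu' e p != 0.
  apply: contraTneq isT => e0; have [x] := volume_neq0 mu' p.
  by rewrite (form_vanish (topform_linear mu') (topform_alt mu') h3 span e0) eqxx.
pose F x := mu x * mu' e - mu' x * mu e.
have Fp x : mu x p * mu' e p = mu' x p * mu e p.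
  apply/eqP; rewrite -subr_eq0; apply/eqP.
  apply: (@form_vanish F _ _ p (psi ^+ 3) e) => //.
  - by move=> u i f X Z; rewrite /F !topform_linear; ring.
  - by move=> u i j ij uij; rewrite /F !(topform_alt _ ij uij) !mul0r subrr.
  - by rewrite /F cfunD cfunN !cfunM mulrC subrr.
apply: (mulIf e0); rewrite mulrAC Fp -[RHS]mulrA Fp; ring.
Qed.

End TopForms.

(** * Divergence, hamiltonian and modular vector fields *)

Section Divergence.
Variables (R : realType) (n : nat) (M : manifold R n).
Local Notation C := (cfun M).
Local Notation VF := (vfield M).
Implicit Types (v : 'I_n -> VF) (X Y : VF) (mu : volume_form M) (d f : C).

Lemma cfun_eq0 f :
  (forall p, exists2 c : C, c p != 0 & c * f = 0) -> f = 0.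
Proof.
move=> H; apply: cfun_ext => p; have [c cp cf] := H p.
have /eqP := congr1 (fun g : C => g p) cf.
by rewrite cfunM mulf_eq0 (negPf cp) /= => /eqP.
Qed.

Lemma divergence_unique mu X d d' :
  is_divergence mu X d -> is_divergence mu X d' -> d = d'.
Proof.
move=> Xd Xd'; apply/subr0_eq/cfun_eq0 => p.
have [v vp] := volume_neq0 mu p; exists (mu v) => //.
by rewrite mulrBr !(mulrC (mu v)) -Xd -Xd' subrr.
Qed.

Lemma is_divergenceE mu X d : is_divergence mu X d -> forall v,
  X (mu v) = d * mu v + \sum_(i < n) mu [eta v with i |-> bracket X (v i)] :> C.
Proof. by move=> H v; rewrite -H /lie_topform subrK. Qed.

Lemma bracketE X Y f : bracket X Y f = X (Y f) - Y (X f) :> C. Proof. by []. Qed.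

(** Expand X (Y (mu v)) by applying [is_divergenceE] twice, and antisymmetrize.
    The terms D, in which X and Y act on two different entries of v, are
    exchanged by swapping X and Y, so they cancel; when they act on the same entry,
    the Jacobi identity for vector fields applies. *)
Lemma divergence_bracket mu X Y d d' :
  is_divergence mu X d -> is_divergence mu Y d' ->
  is_divergence mu (bracket X Y) (X d' - Y d).
Proof.
move=> /is_divergenceE dX /is_divergenceE dY v.
pose D (Z W : VF) := \sum_(i < n) \sum_(j < n | j != i)
  mu [eta [eta v with i |-> bracket W (v i)] with j |-> bracket Z (v j)].
have DC : D X Y = D Y X.
  rewrite /D [RHS](exchange_big_dep xpredT)//=; apply: eq_bigr => i _.
  under [RHS]eq_bigl do rewrite eq_sym.
  apply: eq_bigr => j ji; congr (mu _); apply/funext => k /=.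
  by case: (eqVneq k j) => [->|//]; rewrite (negPf ji).
have second (Z W : VF) dZ dW :
    (forall v, Z (mu v) = dZ * mu v +
       \sum_(i < n) mu [eta v with i |-> bracket Z (v i)] :> C) ->
    (forall v, W (mu v) = dW * mu v +
       \sum_(i < n) mu [eta v with i |-> bracket W (v i)] :> C) ->
    Z (W (mu v)) = Z dW * mu v + dW * dZ * mu v
      + dW * (\sum_(i < n) mu [eta v with i |-> bracket Z (v i)])
      + dZ * (\sum_(i < n) mu [eta v with i |-> bracket W (v i)])
      + \sum_(i < n) mu [eta v with i |-> bracket Z (bracket W (v i))]
      + D Z W :> C.
  move=> HZ HW; rewrite HW vfieldD vfieldM HZ vfield_sumr.
  rewrite [X in _ + X = _](eq_bigr (fun i : 'I_n => dZ * mu [eta v with i |-> bracket W (v i)]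
    + (mu [eta v with i |-> bracket Z (bracket W (v i))] +
      \sum_(j < n | j != i)
  mu [eta [eta v with i |-> bracket W (v i)] with j |-> bracket Z (v j)]))).
    rewrite big_split big_split /= -mulr_sumr -/(D Z W); ring.
  move=> i _; rewrite HZ; congr (_ + _); rewrite (bigD1 i)//=; congr (_ + _).
    congr (mu _); apply/funext => k /=; rewrite eqxx.
    by case: eqP.
  by apply: eq_bigr => j ji; rewrite (negPf ji).
(* The expansions differ only in X d', Y d and the double brackets. *)
rewrite /lie_topform bracketE (second X Y d d')// (second Y X d' d)// DC.
rewrite [X in _ - X = _](eq_bigr (fun i : 'I_n => mu [eta v with i |-> bracket X (bracket Y (v i))]
   - mu [eta v with i |-> bracket Y (bracket X (v i))])).
  rewrite sumrB; ring.
move=> i _.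
have -> : bracket (bracket X Y) (v i) =
    (- 1) *: bracket Y (bracket X (v i)) + bracket X (bracket Y (v i)).
  apply: vfield_ext => f; rewrite vfieldDl vfieldZl !bracketE !vfieldB; ring.
by rewrite topform_linear mulN1r addrC.
Qed.

End Divergence.

Section Poisson.
Variables (R : realType) (n : nat) (M : manifold R n).
Local Notation C := (cfun M).
Local Notation VF := (vfield M).
Local Notation OF := (oneform M).
Implicit Types (X Y : VF) (f g h : C) (al be : OF) (pi : bivector M).

Lemma oneform0 al : al 0 = 0 :> C.
Proof. by apply: (@addrI C (al 0)); rewrite -oneformD !addr0. Qed.
Lemma oneformZ al h X : al (h *: X) = h * al X :> C.
Proof. by rewrite -[h *: X]addr0 oneform_linear oneform0 addr0. Qed.
Lemma oneformN al X : al (- X) = - al X :> C.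
Proof. by rewrite -scaleN1r oneformZ mulN1r. Qed.
Lemma oneform_sumr al m (F : 'I_m -> VF) : al (\sum_l F l) = \sum_l al (F l) :> C.
Proof. by apply: (big_morph (al : VF -> C)); [exact: oneformD|exact: oneform0]. Qed.
Lemma oneformDl al be X : (al + be) X = al X + be X :> C. Proof. by []. Qed.
Lemma oneformNl al X : (- al) X = - al X :> C. Proof. by []. Qed.
Lemma oneformZl h al X : (h *: al) X = h * al X :> C. Proof. by []. Qed.
Lemma oneform_suml m (F : 'I_m -> OF) X : (\sum_l F l) X = \sum_l F l X :> C.
Proof. by apply: (big_morph (fun al : OF => al X : C)). Qed.
Lemma oneform_ext al be : (forall X, al X = be X :> C) -> al = be.
Proof. by move=> ab; apply/val_inj/funext. Qed.
Lemma difE f X : dif f X = X f :> C. Proof. by []. Qed.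
Lemma lie1E X al Y : lie1 X al Y = X (al Y) - al (bracket X Y) :> C.
Proof. by []. Qed.

Lemma difB f g : dif (f - g) = dif f - dif g.
Proof. by apply: oneform_ext => X; rewrite oneformDl oneformNl !difE vfieldB. Qed.
Lemma difN f : dif (- f) = - dif f.
Proof. by apply: oneform_ext => X; rewrite oneformNl !difE vfieldN. Qed.

(** By [local_frame], psi^3 al is a combination with coefficients al (e l) of the
    1-forms psi d(Y l) - Y l d psi, which are combinations of exact ones. *)
Lemma oneform_tensor_eq0 (T : OF -> C) :
  (forall h al be, T (h *: al + be) = h * T al + T be) ->
  (forall f, T (dif f) = 0) -> forall al, T al = 0.
Proof.
move=> Tlin Tdif al; apply: cfun_eq0 => p.
have [psi [Y [e [psip fr]]]] := local_frame p.
exists (psi ^+ 3); first by rewrite cfunX expf_neq0.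
have T0 : T 0 = 0.
  by have := Tlin (-1) 0 0; rewrite scaler0 addr0 mulN1r addNr.
have TZ h be : T (h *: be) = h * T be by rewrite -[h *: be]addr0 Tlin T0 addr0.
have TD be ga : T (be + ga) = T be + T ga.
  by have := Tlin 1 be ga; rewrite scale1r mul1r.
have -> : psi ^+ 3 * T al = T (psi ^+ 3 *: al) by rewrite TZ.
have -> : psi ^+ 3 *: al =
    \sum_l al (e l) *: (psi *: dif (Y l) + (- Y l) *: dif psi).
  apply: oneform_ext => X; rewrite oneformZl -oneformZ fr oneform_sumr oneform_suml.
  apply: eq_bigr => l _.
  by rewrite oneformZ oneformZl oneformDl !oneformZl !difE mulNr mulrC.
rewrite (big_morph T TD T0) big1// => l _.
by rewrite TZ Tlin TZ !Tdif !mulr0 addr0 mulr0.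
Qed.

Lemma sharpN pi al be : be (sharp pi al) = - al (sharp pi be) :> C.
Proof.
have := sharp_alt pi (be + al); rewrite linearD oneformDl !oneformD !sharp_alt.
by rewrite add0r addr0 => /eqP; rewrite addr_eq0 => /eqP.
Qed.

Lemma hamiltonianN pi f g : hamiltonian pi f g = - hamiltonian pi g f :> C.
Proof. exact: (sharpN pi (dif f) (dif g)). Qed.

Lemma lie1_dif X f : lie1 X (dif f) = dif (X f).
Proof.
by apply: oneform_ext => Y; rewrite lie1E !difE bracketE opprB addrC subrK.
Qed.

Lemma lie_bivectorE X pi al be :
  lie_bivector X pi al be = be (bracket X (sharp pi al) - sharp pi (lie1 X al)).
Proof.
by rewrite /lie_bivector /pairing lie1E oneformD oneformN; ring.
Qed.

(** This is L_X pi = 0 tested on exact forms, that is, X is a derivation of the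
    Poisson bracket. *)
Definition preserves_hamiltonians pi X : Prop :=
  forall f, bracket X (hamiltonian pi f) = hamiltonian pi (X f).

(** The difference of the two sides is tensorial in al, because the terms in X h
    arising from h al are the same on both. *)
Lemma bracket_sharp pi X al : preserves_hamiltonians pi X ->
  bracket X (sharp pi al) = sharp pi (lie1 X al).
Proof.
move=> HX; apply: vfield_ext => g; apply/subr0_eq.
pose T al := bracket X (sharp pi al) g - sharp pi (lie1 X al) g.
apply: (@oneform_tensor_eq0 T) => [h be ga|f]; rewrite /T; last first.
  by have := HX f; rewrite /hamiltonian lie1_dif => ->; rewrite subrr.
have -> : lie1 X (h *: be + ga) = h *: lie1 X be + (X h *: be + lie1 X ga).
  apply: oneform_ext => Y.
  rewrite !(oneformDl, oneformZl, lie1E) vfieldD vfieldM; ring.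
rewrite !(linearP (sharp pi)).
rewrite !(vfieldDl, vfieldZl, bracketE) !vfieldD vfieldM; ring.
Qed.

Lemma preserves_poisson_field pi X : preserves_hamiltonians pi X -> poisson_field pi X.
Proof.
by move=> HX al be; rewrite lie_bivectorE bracket_sharp// subrr oneform0.
Qed.

(** The Jacobi identity, as an equality of derivations of the third function: in
    this form N can be applied to it. *)
Definition hamiltonian_morphism pi : Prop := forall f g,
  bracket (hamiltonian pi f) (hamiltonian pi g) =
  hamiltonian pi (hamiltonian pi f g).

Lemma jacobi_hamiltonian pi : jacobi pi -> hamiltonian_morphism pi.
Proof.
move=> J f g; apply: vfield_ext => h; rewrite bracketE.
have := J f g h.
rewrite -![poisson_bracket _ _ _]/(hamiltonian pi _ _).
rewrite (hamiltonianN pi h f) (hamiltonianN pi h (hamiltonian pi f g)) vfieldN.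
by move=> /eqP; rewrite subr_eq0 => /eqP.
Qed.

(** Take divergences in [H_f, H_g] = H_{f,g}: this gives
    X {f, g} = H_f (X g) - H_g (X f), where X f is the divergence of H_f. *)
Lemma modular_preserves pi (mu : volume_form M) X : hamiltonian_morphism pi ->
  is_modular_field pi mu X -> preserves_hamiltonians pi X.
Proof.
move=> Hpi HX f; apply: vfield_ext => g.
have E : X (hamiltonian pi f g) =
    hamiltonian pi f (X g) - hamiltonian pi g (X f) :> C.
  apply: (divergence_unique (mu := mu)); first exact: HX.
  by rewrite -Hpi; exact: divergence_bracket.
by rewrite bracketE E (hamiltonianN pi (X f)); ring.
Qed.

End Poisson.

Section ModularChange.
Variables (R : realType) (n : nat) (M : manifold R n).
Local Notation C := (cfun M).
Local Notation VF := (vfield M).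

(** The sums over i in the two divergence identities agree after multiplication by
    mu' v for mu and by mu v for mu', by [volume_rank1]; what remains is
    mu v * H_f (mu' v) - mu' v * H_f (mu v), and H_f a = - H_a f. *)
Lemma modular_change (pi : bivector M) (mu mu' : volume_form M) (X X' : VF) v :
  is_modular_field pi mu X -> is_modular_field pi mu' X' ->
  (mu v * mu' v) *: (X' - X) =
  mu' v *: hamiltonian pi (mu v) - mu v *: hamiltonian pi (mu' v).
Proof.
move=> HX HX'; apply: vfield_ext => f.
have e1 := is_divergenceE (HX f) v; have e2 := is_divergenceE (HX' f) v.
have S : mu v * \sum_(i < n) mu' [eta v with i |-> bracket (hamiltonian pi f) (v i)]
  = mu' v * \sum_(i < n) mu [eta v with i |-> bracket (hamiltonian pi f) (v i)].
  by rewrite !mulr_sumr; apply: eq_bigr => i _; exact: volume_rank1.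
rewrite !(vfieldDl, vfieldNl, vfieldZl) !(hamiltonianN pi _ f) e1 e2.
ring: S.
Qed.

End ModularChange.

(** * Poisson-Nijenhuis manifolds *)

Section PN.
Variables (R : realType) (n : nat) (M : manifold R n) (P : poisson_nijenhuis M).
Local Notation C := (cfun M).
Local Notation VF := (vfield M).
Local Notation OF := (oneform M).
Local Notation N := (pn_N P).
Local Notation H0 := (hamiltonian (pn_pi0 P)).
Local Notation H1 := (hamiltonian (pn_pi1 P)).
Implicit Types (X Y : VF) (f g : C).

Lemma form_bracket_dif (pi : bivector M) (al : OF) g :
  form_bracket pi al (dif g) = - lie1 (hamiltonian pi g) al.
Proof. by rewrite /form_bracket lie1_dif addrAC subrr add0r. Qed.

Lemma form_bracketC (pi : bivector M) (al be : OF) :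
  form_bracket pi al be = - form_bracket pi be al.
Proof.
rewrite /form_bracket !opprB /pairing.
have -> : be (sharp pi al) = - al (sharp pi be) :> C by exact: sharpN.
by rewrite difN opprK addrC addrA.
Qed.

Lemma hamiltonian1E f : H1 f = N (H0 f). Proof. by []. Qed.

Lemma transposeE (al : OF) X : transpose N al X = al (N X) :> C. Proof. by []. Qed.

(** Condition [pn_form_bracket] on exact forms.  It takes this short form because
    [al, dg] = - L_{H_g} al for every 1-form al. *)
Lemma pn_form_bracket_dif f g :
  dif (H1 f g) = lie1 (H0 f) (transpose N (dif g)) - lie1 (H0 g) (transpose N (dif f))
                 - transpose N (dif (H0 f g)).
Proof.
have := pn_form_bracket P (dif f) (dif g).
rewrite (form_bracketC _ (dif f) (transpose N (dif g))) !form_bracket_dif !lie1_dif.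
rewrite -difN -hamiltonianN => ->.
rewrite opprK -difN -hamiltonianN; congr (_ - _).
by rewrite addrC.
Qed.

(** Vanishing torsion, with N in front of the right-hand side: identities for
    pi_1 follow by applying N to identities for pi_0. *)
Lemma bracket_tensor X Y : bracket (N X) (N Y) =
  N (bracket (N X) Y + bracket X (N Y) - N (bracket X Y)).
Proof.
have := pn_torsion P X Y; rewrite /torsion => /eqP; rewrite subr_eq0 => /eqP <-.
by rewrite linearB linearD.
Qed.

Lemma pn_hamiltonian_morphism0 : hamiltonian_morphism (pn_pi0 P).
Proof. exact/jacobi_hamiltonian/pn_jacobi. Qed.

Lemma bracketC X Y : bracket X Y = - bracket Y X.
Proof. by apply: vfield_ext => f; rewrite vfieldNl !bracketE opprB. Qed.

Lemma tensor_hamiltonian0 f : N (H0 f) = sharp (pn_pi0 P) (transpose N (dif f)).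
Proof. exact: pn_compatible. Qed.

(** Apply pi_0^sharp to [pn_form_bracket_dif]: it turns L_{H_f} into the bracket
    with H_f, and N^* into N.  The result is the argument of N in
    [bracket_tensor]. *)
Lemma pn_hamiltonian_morphism1 : hamiltonian_morphism (pn_pi1 P).
Proof.
move=> f g; rewrite !(hamiltonian1E (H1 _ _)) !hamiltonian1E bracket_tensor; congr (N _).
have Hf h : preserves_hamiltonians (pn_pi0 P) (H0 h) by exact: pn_hamiltonian_morphism0.
rewrite /hamiltonian pn_form_bracket_dif !linearB /= -!bracket_sharp//.
rewrite -!tensor_hamiltonian0 pn_hamiltonian_morphism0.
by rewrite (bracketC (H0 g)) opprK (addrC (bracket (H0 f) _)).
Qed.

(** After removing N with [bracket_tensor], both sides are applied to g.  The
    relation then follows from [pn_form_bracket_dif], evaluated at X. *)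
Lemma preserves_hamiltonians_tensor X : preserves_hamiltonians (pn_pi0 P) X ->
  preserves_hamiltonians (pn_pi1 P) (N X).
Proof.
move=> HX f; rewrite !hamiltonian1E bracket_tensor; congr (N _).
rewrite (tensor_hamiltonian0 f) bracket_sharp// HX.
apply: vfield_ext => g.
have := congr1 (fun al : OF => al X : C) (pn_form_bracket_dif f g).
rewrite !(oneformDl, oneformNl, lie1E, transposeE, difE) => K.
rewrite !(vfieldDl, vfieldNl, bracketE).
have eg (al : OF) : sharp (pn_pi0 P) al g = - al (H0 g) :> C.
  by rewrite -[LHS]/(dif g (sharp _ al)) sharpN.
rewrite eg lie1E !transposeE !difE HX.
rewrite (hamiltonianN _ ((N X) f)) -(hamiltonian1E g) (hamiltonianN _ g f) vfieldN K.
rewrite !(bracketC (H0 _) X) !HX !(linearN N) !vfieldNl; ring.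
Qed.

Lemma preserves_hamiltoniansB (pi : bivector M) X Y : preserves_hamiltonians pi X ->
  preserves_hamiltonians pi Y -> preserves_hamiltonians pi (X - Y).
Proof.
move=> HX HY f; apply: vfield_ext => g; rewrite vfieldDl vfieldNl.
rewrite /hamiltonian difB linearB vfieldDl vfieldNl -!/(hamiltonian _ _) -HX -HY.
by rewrite !bracketE !(vfieldDl, vfieldNl) vfieldB; ring.
Qed.

End PN.

Theorem lemma1 (R : realType) (n : nat) (M : manifold R n)
    (P : poisson_nijenhuis M) (orM : orientable M) :
  (forall (mu mu' : volume_form M) (X0 X1 X0' X1' : vfield M),
     is_modular_field (pn_pi0 P) mu X0 ->
     is_modular_field (pn_pi1 P) mu X1 ->
     is_modular_field (pn_pi0 P) mu' X0' ->
     is_modular_field (pn_pi1 P) mu' X1' ->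
     X1 - pn_N P X0 = X1' - pn_N P X0') /\
  (forall (mu : volume_form M) (X0 X1 : vfield M),
     is_modular_field (pn_pi0 P) mu X0 ->
     is_modular_field (pn_pi1 P) mu X1 ->
     poisson_field (pn_pi1 P) (X1 - pn_N P X0)).
Proof.
split=> [mu mu' X0 X1 X0' X1' HX0 HX1 HX0' HX1'|mu X0 X1 HX0 HX1].
- suff E : X1' - X1 = pn_N P (X0' - X0).
    by rewrite -(subrK X1 X1') E linearB [RHS]addrC addrA addKr addrC.
  apply: vfield_ext => f; apply/subr0_eq/cfun_eq0 => p.
  have [v vp] := volume_neq0 mu p; have [w wp] := volume_neq0 mu' p.
  exists (mu v * mu' v).
    rewrite cfunM mulf_neq0//.
    have := congr1 (fun h : cfun M => h p) (volume_rank1 mu mu' v w).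
    rewrite !cfunM; apply: contra_eqN => /eqP ->.
    by rewrite mul0r mulf_neq0.
  have NZ c Z : c *: pn_N P Z = pn_N P (c *: Z) by rewrite linearZ.
  rewrite mulrBr -!vfieldZl NZ.
  rewrite (modular_change v HX0 HX0') (modular_change v HX1 HX1').
  by rewrite linearB !linearZ subrr.
- apply: preserves_poisson_field; apply: preserves_hamiltoniansB.
  + exact: modular_preserves (@pn_hamiltonian_morphism1 _ _ _ P) HX1.
  + exact/preserves_hamiltonians_tensor/(modular_preserves (@pn_hamiltonian_morphism0 _ _ _ P) HX0).
Qed.
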